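(* Let $\sigma$ be a probability measure on $(0,1/2]$ and let $\beta_m,\beta_s\in(0,1]$. The state $\bar p=(1,0,0,\ldots)$ is positive recurrent for $K_{\sigma,\beta_m,\beta_s}$ if and only if $\int \frac1x\,d\sigma(x)<\infty$. If, however, $$\int_0^{1/2}\frac{1}{\sigma[(0,x]]}\,dx<\infty,$$ then $\bar p$ is a transient state for $K_{\sigma,\beta_m,\beta_s}$.
   Context: For a nonnegative sequence $x=(x_i)_{i\ge1}$ write $|x|=\sum_i x_i$ and $|x|_2^2=\sum_i x_i^2$. Let $\bar\Omega_{\le}$ be the set of sequences $p=(p_i)_{i\ge1}$ with $p_1\ge p_2\ge\dots\ge0$ and $|p|\le1$ (including the zero sequence), with the topology induced from the product topology on $\mathbb R^{\mathbb N}$ and its Borel $\sigma$-field. For $i\ne j$, $M_{ij}p$ denotes the nonincreasing sequence obtained from $p$ by merging $p_i$ and $p_j$ into one part $p_i+p_j$. For $0<u<1$, $S_i^up$ denotes the nonincreasing sequence obtained from $p$ by splitting $p_i$ into the two parts $up_i$ and $(1-u)p_i$. For a probability measure $\sigma$ on $(0,1/2]$ and $\beta_m,\beta_s\in(0,1]$, define the Markov kernel on $\bar\Omega_\le$ $$K_{\sigma,\beta_m,\beta_s}(p,\cdot)=2\beta_m\sum_{i<j}p_ip_j\,\delta_{M_{ij}p}(\cdot)+\beta_s\sum_i p_i^2\int\delta_{S_i^up}(\cdot)\,d\sigma(u)+\bigl(1-\beta_m|p|^2+(\beta_m-\beta_s)|p|_2^2\bigr)\delta_p(\cdot).$$ Let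 $(p(n))_{n\ge0}$ be the Markov chain with this kernel started at $p(0)=\bar p$, with law $P_{\bar p}$ and expectation $E_{\bar p}$, and let $H:=\min\{n\ge1: p(n)=p(0)\}$ (with $H=\infty$ if there is no such $n$). The state $\bar p$ is positive recurrent if $E_{\bar p}[H]<\infty$, and transient if $P_{\bar p}[H<\infty]<1$. The convention $1/0=\infty$ is used in the integral. *)

(* Defs.v *)
From HB Require Import structures.
From mathcomp Require Import all_boot all_order all_algebra.
From mathcomp Require Import all_classical all_reals all_analysis.

Set Implicit Arguments.
Unset Strict Implicit.
Unset Printing Implicit Defensive.

Import Order.TTheory GRing.Theory Num.Theory.
Import numFieldNormedType.Exports.

Local Open Scope classical_set_scope.
Local Open Scope ring_scope.

(** Sequences are indexed from 0: [p 0, p 1, ...] stand for p_1, p_2, ... *)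

Section partitions.
Context (R : realType).

Definition mass_partition_set : set {ptws nat -> R} :=
  [set p | [/\ (forall i, p i.+1 <= p i), (forall i, 0 <= p i) &
               (\sum_(0 <= i <oo) (p i)%:E <= 1)%E]].

Lemma zero_partition_subproof : (fun=> 0 : R) \in mass_partition_set.
Proof. by rewrite inE; split => //; rewrite eseries0. Qed.

Definition mass_partition : Type := set_type mass_partition_set.

(** The topology induced by the product topology. *)
HB.instance Definition _ :=
  Topological.copy mass_partition (set_type mass_partition_set).

HB.instance Definition _ := isPointed.Build mass_partition
  (exist (fun p => p \in mass_partition_set) _ zero_partition_subproof).

HB.instance Definition _ :=
  @isMeasurable.Build (sigma_display (@open mass_partition)) mass_partition
    <<s @open mass_partition >>
    (@sigma_algebra0 _ setT (@open mass_partition))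
    (@sigma_algebraC _ (@open mass_partition))
    (@sigma_algebra_bigcup _ setT (@open mass_partition)).

Definition parts (p : mass_partition) : nat -> R := set_val p.

Coercion parts : mass_partition >-> Funclass.

Lemma unit_partition_subproof :
  (fun i => if i is 0%N then 1 else 0 : R) \in mass_partition_set.
Proof.
rewrite inE; split; [by case=> [|i]//=|by case=> [|i]//=|].
rewrite (@nneseries_split _ _ 0%N 1%N) => [|[|k] _]; rewrite ?lee_fin//.
rewrite add0n big_nat1 eseries0 ?adde0// => -[]//.
Qed.

Definition unit_partition : mass_partition :=
  exist (fun p => p \in mass_partition_set) _ unit_partition_subproof.

Definition mass (p : mass_partition) : R := fine (\sum_(0 <= i <oo) (p i)%:E)%E.

Definition sqnorm (p : mass_partition) : R :=
  fine (\sum_(0 <= i <oo) (p i ^+ 2)%:E)%E.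

(** Zeros are not parts: [q] rearranges [r] when every positive value has the
    same multiplicity in both. *)
Definition same_parts (q r : nat -> R) : Prop :=
  forall x, 0 < x -> ([set i | q i = x] #= [set i | r i = x])%card.

(** The nonincreasing rearrangement of [r], which exists and is unique as soon
    as [r] is nonnegative with sum at most 1. *)
Definition rearrange (r : nat -> R) : mass_partition :=
  xget (point : mass_partition) [set q : mass_partition | same_parts q r].

Definition merge_parts (i j : nat) (p : mass_partition) : mass_partition :=
  rearrange (fun k => if k == i then p i + p j else if k == j then 0 else p k).

(** Part [i] becomes [u * p i], and [(1 - u) * p i] is put in front. *)
Definition split_part (i : nat) (u : R) (p : mass_partition) : mass_partition :=
  rearrange (fun k => if k is k'.+1 then
                        if k' == i then u * p i else p k'
                      else (1 - u) * p i).

Definition split_merge_kernel (sigma : probability R R) (bm bs : R)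
    (p : mass_partition) (A : set mass_partition) : \bar R :=
  ((2 * bm)%:E *
     (\esum_(ij in [set ij : nat * nat | (ij.1 < ij.2)%N])
        ((p ij.1 * p ij.2)%:E * \d_(merge_parts ij.1 ij.2 p) A))
   + bs%:E *
     (\sum_(0 <= i <oo)
        ((p i ^+ 2)%:E *
         (\int[sigma]_(u in `]0%R, 2^-1%R]) \d_(split_part i u p) A)))
   + (1 - bm * mass p ^+ 2 + (bm - bs) * sqnorm p)%:E * \d_p A)%E.

End partitions.

Arguments unit_partition {R}.

Section chains.
Context (R : realType) (dS : measure_display) (S : measurableType dS).
Context (d : measure_display) (T : measurableType d).

Definition history (X : nat -> T -> S) (n : nat) : set (set T) :=
  <<s [set F | exists k (B : set S),
         [/\ (k <= n)%N, measurable B & F = X k @^-1` B]] >>.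

(** [X] is a realization on [(T, P)] of the Markov chain with kernel [K] started
    at [x]: the last condition says that [K (X n) B] is a version of the
    conditional probability of [X n.+1 \in B] given [X 0, ..., X n]. *)
Definition markov_chain (K : S -> set S -> \bar R) (x : S)
    (P : probability T R) (X : nat -> T -> S) : Prop :=
  [/\ (forall n, measurable_fun [set: T] (X n)),
      {ae P, forall w, X 0%N w = x} &
      forall n (F : set T) (B : set S), history X n F -> measurable B ->
        P (F `&` X n.+1 @^-1` B) = (\int[P]_(w in F) K (X n w) B)%E].

Definition return_time (X : nat -> T -> S) (w : T) : \bar R :=
  ereal_inf [set (n%:R)%:E | n in [set n | (1 <= n)%N /\ X n w = X 0%N w]].

Definition positive_recurrent (P : probability T R) (X : nat -> T -> S) : Prop :=
  (\int[P]_w return_time X w < +oo)%E.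

Definition transient (P : probability T R) (X : nat -> T -> S) : Prop :=
  (P [set w | (return_time X w < +oo)%E] < 1)%E.

End chains.

(* Main.v *)
Require Import Defs.
From HB Require Import structures.
From mathcomp Require Import all_boot all_order all_algebra.
From mathcomp Require Import finmap lra ring zify.
From mathcomp Require Import all_classical all_reals all_analysis measurable_realfun.
Import Order.TTheory GRing.Theory Num.Theory.
Import numFieldNormedType.Exports.
Local Open Scope classical_set_scope.
Local Open Scope ring_scope.

(** Write m for the smallest positive part of a state, N for its number of
    parts, Q for the sum of the squares of its parts, and K f for the
    expectation of f after one step.  Started from the one-part state, the chain
    stays among states with finitely many parts and total mass 1
    ([ae_proper]).  All three claims are proved by applying K to well-chosen
    functions of the parts, along the chain killed when it returns
    ([excursion_step]).  On such states the effect of all merges of a function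
    whose value changes by a term for each of the two merged parts collapses to a
    single sum over parts ([kernel_op_le], [kernel_op_ge]).

    Positive recurrence implies that 1/x is integrable.  A given part of size m
    is merged with probability at most 2 m (1 - m) per step, and splitting can
    only shrink the smallest part.  Hence (1 - m)^2 bounds from below the
    probability that the smallest part is not absorbed in one step; iterating,
    the probability of no return up to time n + 1 is at least
    bs * int (1 - u)^(2n) d sigma(u), and the sum over n dominates
    (bs / 2) * int (1 / u) d sigma(u)  ([positive_recurrent_integral]).

    Integrability of 1/x implies positive recurrence.  For a threshold delta take
    the sum f of 1/x over the parts x < delta.  Merging destroys the term 1/x at a
    rate proportional to x, so in each step it costs f on average at least bm / 2
    times the number of parts below delta; splitting feeds f only through a part
    of int (1 / u) d sigma(u) that is small with delta, unless there are many
    parts  ([inv_sum_drift], [split_gain_le]).  Summed over an excursion, the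
    drift shows that the expected time weighted by the number of parts is
    comparable to the length of the excursion, and that the expected time
    weighted by the number of parts below delta is an arbitrarily small
    proportion of it when delta is small.  So at least half of the excursion is
    spent in states with at most N0 parts, all at least delta.  From such a state
    with k + 1 parts the chain moves to one with k parts with probability at
    least bm * delta, so the expected time spent there is bounded inductively in
    k, down to the return, which happens at most once ([level_occupation]).
    This bounds the expected length of the excursion ([duration_bound]).

    Transience.  Let A(m) be a multiple of the integral of 1 / sigma (0, y] over
    (0, m/2].  The positive part of 1 - A(m) - 4 m N is subharmonic away from the
    one-part state, where it vanishes.  Indeed the loss of the smallest
    part, of probability about 2 m, is paid for by the decrease of 4 m N
    under merging, while the increase of 4 m N under splitting, of order m Q, is
    paid for by A: with probability at least bs * Q * sigma (0, m/2] the smallest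
    part is at least halved, and then A(m) drops by at least a multiple of
    m / sigma (0, m/2]  ([escape_weight_step]).  As A tends to 0 at 0, the
    function is positive after a first split that creates a small enough part,
    and its expectation bounds the survival probability from below. *)

Set Implicit Arguments.
Unset Strict Implicit.
Unset Printing Implicit Defensive.

(** * Symmetric functionals and the nonincreasing rearrangement *)

Section rearrangement.
Context (R : realType).
Implicit Types (q r : nat -> R) (phi : R -> R) (x y : R).

(** When [phi 0 = 0] this depends only on the parts.  Mass, number of parts and
    most test functions below are of this form, so that rearranged sequences need
    not be known explicitly. *)
Definition part_sum phi r : \bar R := (\sum_(0 <= i <oo) (phi (r i))%:E)%E.

Lemma part_sum_ge0 phi r : (forall i, 0 <= r i) ->
  (forall x, 0 <= x -> 0 <= phi x) -> (0 <= part_sum phi r)%E.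
Proof.
by move=> r0 phi0; apply: nneseries_ge0 => i _ _; rewrite lee_fin phi0.
Qed.

Lemma part_sum_support phi r : (forall i, 0 <= r i) ->
  (forall x, 0 <= x -> 0 <= phi x) -> phi 0 = 0 ->
  part_sum phi r = (\esum_(i in [set i | (0 < r i)%R]) (phi (r i))%:E)%E.
Proof.
move=> r0 phi0 phi00; rewrite /part_sum nneseries_esumT => [|i]; last first.
  by rewrite lee_fin phi0.
rewrite [RHS]esum_mkcond; apply: eq_esum => i _; case: ifPn => // /negP ri'.
have ri : r i <= 0 by rewrite leNgt; apply/negP => h; apply/ri'/mem_set.
have -> : r i = 0 by apply/eqP; rewrite eq_le ri r0.
by rewrite phi00.
Qed.

(** The bijections between the level sets [r = x] and [q = x], one for each
    [x > 0], glue to a bijection between the supports that preserves values. *)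
Lemma same_parts_part_sum phi q r : (forall i, 0 <= q i) -> (forall i, 0 <= r i) ->
  (forall x, 0 <= x -> 0 <= phi x) -> phi 0 = 0 ->
  same_parts q r -> part_sum phi q = part_sum phi r.
Proof.
move=> q0 r0 phi0 phi00 qr; rewrite !part_sum_support//.
have : forall x, exists f : nat -> nat,
    0 < x -> set_bij [set i | r i = x] [set i | q i = x] f.
  move=> x; have [x0|x0] := ltP 0 x; last by exists id.
  by have := qr x x0; rewrite card_eq_sym => /card_set_bijP[f bf]; exists f.
move=> /choice[F HF].
(* the bijections are glued by sending [i] along the one of its own value *)
pose e i := F (r i) i.
have qe i : 0 < r i -> q (e i) = r i.
  by move=> ri; have [+ _ _] := HF _ ri; apply.
rewrite (@reindex_esum R _ _ [set i | 0 < r i] [set i | 0 < q i] e).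
  by apply: eq_esum => i /= ri; rewrite qe.
split=> [i /= ri|i j|k /= qk].
- by rewrite qe.
- rewrite !in_setE/= => ri rj eij.
  have rij : r i = r j by rewrite -(qe _ ri) -(qe _ rj) eij.
  have [_ inj _] := HF _ ri; apply: inj; rewrite ?in_setE//=.
  by move: eij; rewrite /e rij.
- have [_ _ /(_ k erefl)[i /= ri <-]] := HF _ qk.
  by exists i; rewrite /= ?ri// /e ri.
Qed.

(** Thus the set of terms above a level does not change as the level approaches
    [x] from one side, which relates strict to weak inequalities. *)
Lemma value_gap (s : seq R) x :
  exists2 e, 0 < e & forall z, z \in s -> z != x -> e <= `|z - x|.
Proof.
elim: s => [|a s [e e0 IH]]; first by exists 1.
have [->|ax] := eqVneq a x.
  exists e => // z; rewrite inE => /orP[/eqP->|zs]; first by rewrite eqxx.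
  exact: IH.
exists (Num.min e `|a - x|); first by rewrite lt_min e0 normr_gt0 subr_eq0.
move=> z; rewrite inE ge_min => /orP[/eqP->|zs zx]; first by rewrite lexx orbT.
by rewrite IH.
Qed.

Section sort.
Variable r : nat -> R.
Hypotheses (r0 : forall i, 0 <= r i) (r1 : (part_sum id r <= 1)%E).

Let above x := [set i | x < r i].
Let nabove x := #|` fset_set (above x)|%fset.

Let above_finite x : 0 < x -> finite_set (above x).
Proof.
move=> x0; apply: contrapT => infA.
have [n nx] : exists n : nat, 1 < n%:R * x.
  exists (Num.bound x^-1).
  by rewrite -ltr_pdivrMr// div1r; apply: archi_boundP; rewrite invr_ge0 ltW.
have [B BA Bn] := infinite_set_fset n infA.
have : (part_sum id r <= 1)%E by [].
apply/negP; rewrite -ltNge.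
apply: (@lt_le_trans _ _ (#|` B|%fset%:R * x)%:E).
  by rewrite lte_fin; apply: lt_le_trans nx _; rewrite ler_pM2r// ler_nat.
rewrite /part_sum nneseries_esumT => [|i]; last by rewrite lee_fin.
apply: esum_ge; exists [set` B]; first by split; [exact: finite_fset|].
rewrite fsbig_finite//= set_fsetK sumEFin lee_fin mulr_natl cardfE -sumr_const.
rewrite big_seq_fsetE/=.
by apply: ler_sum => i _; apply/ltW/BA => /=; exact: fsvalP.
Qed.

Let sub_above x y : x <= y -> above y `<=` above x.
Proof. by move=> xy i /=; apply: le_lt_trans. Qed.

Let nabove_le x y : 0 < x -> x <= y -> (nabove y <= nabove x)%N.
Proof.
move=> x0 xy; apply: fsubset_leq_card; rewrite -fset_set_sub.
- exact: sub_above.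
- exact/above_finite/(lt_le_trans x0).
- exact: above_finite.
Qed.

Let sup_set k := [set x : R | x = 0 \/ 0 < x /\ (k < nabove x)%N].

Let sup_set0 k : sup_set k !=set0. Proof. by exists 0; left. Qed.

Let sup_set_ub k : ubound (sup_set k) 1.
Proof.
move=> x [->//|[x0 kx]].
have [i /= xi] : above x !=set0.
  apply/set0P/eqP => h; move: kx.
  by rewrite /nabove h fset_set0 cardfs0.
apply/(le_trans (ltW xi)); rewrite -lee_fin; apply: le_trans r1.
rewrite /part_sum (nneseriesD1 (n := i))//= ?leeDl//.
by apply: nneseries_ge0 => j _ _; rewrite lee_fin.
by move=> j _; rewrite lee_fin.
Qed.

(* the [k]-th largest value is the last level exceeded by more than [k] terms *)
Let sorted k := sup (sup_set k).

Let sorted_gt k y : 0 < y -> (y < sorted k) = (k < nabove y)%N.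
Proof.
move=> y0; apply/idP/idP => [/(sup_gt (sup_set0 k))[x [->|[x0 kx]] yx]|ky].
- by move: (lt_trans y0 yx); rewrite ltxx.
- exact: leq_trans kx (nabove_le y0 (ltW yx)).
have [e e0 He] := value_gap [seq r i | i <- fset_set (above y)] y.
have eqA : above (y + e / 2) = above y.
  apply/seteqP; split; first by apply: sub_above; rewrite lerDl divr_ge0// ltW.
  move=> i; rewrite /above/= => yi; rewrite -ltrBrDl.
  have := He (r i); rewrite (gt_eqF yi) => /(_ _ isT) h.
  apply: (@lt_le_trans _ _ e); first by rewrite ltr_pdivrMr//; lra.
  apply: le_trans (h _) _; last by rewrite ger0_norm// subr_ge0 ltW.
  by apply: map_f; rewrite in_fset_set ?in_setE//; exact: above_finite.
apply: (@lt_le_trans _ _ (y + e / 2)); first by rewrite ltrDl divr_gt0.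
apply: ub_le_sup; first by exists 1; exact: sup_set_ub.
right; split; first by rewrite addr_gt0// divr_gt0.
by rewrite /nabove eqA.
Qed.

Let sorted_same_parts : same_parts sorted r.
Proof.
move=> x x0.
have [e e0 He] := value_gap [seq r i | i <- fset_set (above (x / 2))] x.
pose y := x - Num.min e (x / 2).
have x20 : 0 < x / 2 by rewrite divr_gt0.
have yx : y < x by rewrite ltrBlDr ltrDl lt_min e0.
have xy : x / 2 <= y by rewrite /y; case: (leP e (x / 2)) => h; lra.
have y0 : 0 < y by exact: lt_le_trans xy.
have gap z i : y <= z -> z < r i -> x <= r i.
  move=> yz zi; rewrite leNgt; apply/negP => ix.
  have : e <= `|r i - x|.
    apply: He; last by rewrite lt_eqF.
    apply: map_f; rewrite in_fset_set; last exact: above_finite.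
    by rewrite in_setE/=; apply: le_lt_trans xy (le_lt_trans yz zi).
  rewrite ltr0_norm ?subr_lt0// => h.
  have : y <= r i by exact: le_trans yz (ltW zi).
  rewrite /y => h2; have : Num.min e (x / 2) <= e by rewrite ge_min lexx.
  have : y < r i by exact: le_lt_trans yz zi.
  by rewrite /y; lra.
have -> : [set i | r i = x] = above y `\` above x.
  rewrite /above; apply/seteqP; split=> i /= => [->|[yi]]; first by rewrite ltxx.
  move/negP; rewrite -leNgt => ix; apply/eqP; rewrite eq_le ix/=.
  exact: gap yi.
have -> : [set k | sorted k = x] = `I_(nabove y) `\` `I_(nabove x).
  apply/seteqP; split=> k /= => [kx|[ky /negP kx]].
    by rewrite -!sorted_gt// kx yx ltxx.
  move: kx; rewrite -sorted_gt// -leNgt => kx; apply/eqP; rewrite eq_le kx/=.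
  rewrite leNgt; apply/negP => xk.
  pose z := Num.max y (sorted k).
  have yz : y <= z by rewrite le_max lexx.
  have zx : z < x by rewrite gt_max yx.
  have := sorted_gt k (lt_le_trans y0 yz); rewrite ltNge le_max lexx orbT/=.
  move=> /esym/negbT/negP; apply; apply: leq_trans ky _.
  apply: fsubset_leq_card; rewrite -fset_set_sub.
  - move=> i /= yi; apply: lt_le_trans zx _; exact: gap yi.
  - exact: above_finite.
  - by apply: above_finite; exact: lt_le_trans yz.
have fy := above_finite y0.
have fx := above_finite x0.
apply: card_eq_trans (@card_IID _ _) _; rewrite card_eq_sym.
have -> : above y `\` above x = [set` (fset_set (above y) `\` fset_set (above x))%fset].
  by rewrite set_fsetD !fset_setK.
apply/card_eq_fsetP; rewrite cardfsDS// -fset_set_sub//.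
by apply: sub_above; exact: ltW.
Qed.

(** Above each positive level the sorted sequence has as many terms as [r]; the
    number of terms equal to [x] is the difference of two such counts. *)
Lemma same_parts_exists : exists q : mass_partition R, same_parts q r.
Proof.
have sorted_ge0 k : 0 <= sorted k.
  by apply: ub_le_sup; [exists 1; exact: sup_set_ub|left].
have ms : sorted \in @mass_partition_set R.
  rewrite inE; split => // [k|].
    apply: le_sup; last by split; [exact: sup_set0|exists 1; exact: sup_set_ub].
      move=> x hx; exists x; split; last exact: lexx.
      by case: hx => [->|[x0 kx]]; [left|right; split=> //; exact: ltnW].
    exact: sup_set0.
  by rewrite -[leLHS]/(part_sum id sorted) (same_parts_part_sum (r := r)).
by exists (exist (fun p => p \in @mass_partition_set R) _ ms).
Qed.

End sort.
End rearrangement.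

(** * Merging, splitting and measurability of rearrangements *)

Section moves.
Context (R : realType).
Implicit Types (p q : mass_partition R) (r : nat -> R) (phi : R -> R) (u x y : R).

Lemma mass_partitionP p : [/\ (forall i, p i.+1 <= p i), (forall i, 0 <= p i) &
  (part_sum id p <= 1)%E].
Proof. by have := valP p; rewrite inE. Qed.

Lemma part_ge0 p i : 0 <= p i.
Proof. by have [] := mass_partitionP p. Qed.

Lemma part_noninc p i j : (i <= j)%N -> p j <= p i.
Proof.
have [ni _ _] := mass_partitionP p; elim: j => [|j IH].
  by rewrite leqn0 => /eqP->.
by rewrite leq_eqVlt ltnS => /orP[/eqP->//|/IH]; apply: le_trans.
Qed.

Lemma mass_partition_inj p q : (forall i, p i = q i) -> p = q.
Proof. by move=> pq; apply: val_inj; apply/funext. Qed.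

Lemma rearrangeP r : (forall i, 0 <= r i) -> (part_sum id r <= 1)%E ->
  same_parts (rearrange r) r.
Proof.
move=> r0 r1; rewrite /rearrange; case: xgetP => [q -> //|no].
by have [q /no] := same_parts_exists r0 r1.
Qed.

Lemma part_sum_rearrange phi r : (forall i, 0 <= r i) -> (part_sum id r <= 1)%E ->
  (forall x, 0 <= x -> 0 <= phi x) -> phi 0 = 0 ->
  part_sum phi (rearrange r) = part_sum phi r.
Proof.
move=> r0 r1 phi0 phi00; apply: same_parts_part_sum => //.
  exact: part_ge0.
exact: rearrangeP.
Qed.

Definition merge_seq i j r : nat -> R :=
  fun k => if k == i then r i + r j else if k == j then 0 else r k.

Definition split_seq i u r : nat -> R :=
  fun k => if k is k'.+1 then if k' == i then u * r i else r k' else (1 - u) * r i.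

Lemma merge_seq_ge0 i j r : (forall i, 0 <= r i) -> forall k, 0 <= merge_seq i j r k.
Proof. by move=> r0 k; rewrite /merge_seq; case: ifP => _;
  [rewrite addr_ge0|case: ifP]. Qed.

Lemma split_seq_ge0 i u r : 0 <= u <= 1 -> (forall i, 0 <= r i) ->
  forall k, 0 <= split_seq i u r k.
Proof.
move=> /andP[u0 u1] r0 [|k]/=; first by rewrite mulr_ge0// subr_ge0.
by case: ifP => // _; rewrite mulr_ge0.
Qed.

(** The balance is written with additions only, since the sums may be infinite. *)
Lemma part_sum_merge_seq phi i j r : i != j -> (forall i, 0 <= r i) ->
  (forall x, 0 <= x -> 0 <= phi x) -> phi 0 = 0 ->
  (part_sum phi (merge_seq i j r) + (phi (r i))%:E + (phi (r j))%:E =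
   part_sum phi r + (phi (r i + r j))%:E)%E.
Proof.
move=> ij r0 phi0 phi00.
have two (s : nat -> R) : (forall k, 0 <= s k) -> part_sum phi s =
    ((phi (s i))%:E + ((phi (s j))%:E +
      \sum_(0 <= k <oo | (true && (k != i)) && (k != j)) (phi (s k))%:E))%E.
  move=> s0; have h k : (0 <= (phi (s k))%:E)%E by rewrite lee_fin phi0.
  rewrite /part_sum (nneseriesD1 (n := i))// (nneseriesD1 (n := j))//.
  by rewrite eq_sym ij.
rewrite two; last exact: merge_seq_ge0.
rewrite [in RHS]two//.
have -> : (\sum_(0 <= k <oo | (true && (k != i)) && (k != j))
    (phi (merge_seq i j r k))%:E = \sum_(0 <= k <oo | (true && (k != i)) && (k != j))
    (phi (r k))%:E)%E.
  apply: eq_eseriesr => k /andP[/andP[_ /negbTE ki] /negbTE kj].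
  by rewrite /merge_seq ki kj.
rewrite {1}/merge_seq eqxx {1}/merge_seq eqxx eq_sym (negbTE ij) phi00 add0e.
by rewrite [RHS]addeC -!addeA; congr (_ + _)%E; rewrite [RHS]addeA [RHS]addeC.
Qed.

Lemma part_sum_split_seq phi i u r : 0 <= u <= 1 -> (forall i, 0 <= r i) ->
  (forall x, 0 <= x -> 0 <= phi x) ->
  (part_sum phi (split_seq i u r) + (phi (r i))%:E =
   part_sum phi r + (phi (u * r i))%:E + (phi ((1 - u) * r i))%:E)%E.
Proof.
move=> u01 r0 phi0.
rewrite /part_sum nneseries_recl//; last first.
  by move=> k _; rewrite lee_fin phi0// split_seq_ge0.
rewrite -(nneseries_addn 1); last by move=> k; rewrite lee_fin phi0// split_seq_ge0.
rewrite [split_seq i u r 0%N]/=.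
have -> : (\sum_(0 <= k <oo) (phi (split_seq i u r (k + 1)))%:E =
    \sum_(0 <= k <oo) (phi (if k == i then (u * r i)%R else r k))%:E)%E.
  by apply: eq_eseriesr => k _; rewrite addn1.
rewrite (nneseriesD1 (n := i))//; last first.
  move=> k _; rewrite lee_fin phi0//; case: ifP => // _.
  by rewrite mulr_ge0//; case/andP: u01.
rewrite eqxx; rewrite [X in _ = (X + _ + _)%E](nneseriesD1 (n := i))//; last first.
  by move=> k _; rewrite lee_fin phi0.
under eq_eseriesr => k /negbTE ki do rewrite ki.
rewrite [RHS]addeC -[LHS]addeA; congr (_ + _)%E.
by rewrite [LHS]addeC [X in (_ + X)%E]addeC addeA.
Qed.

Lemma addIe_fin (a b : \bar R) x : (a + x%:E = b + x%:E -> a = b)%E.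
Proof. by move=> /(congr1 (fun z => z - x%:E)%E); rewrite !addeK. Qed.

Lemma part_sum_id_merge_seq i j p : i != j ->
  part_sum id (merge_seq i j p) = part_sum id p.
Proof.
move=> ij; have := @part_sum_merge_seq id i j p ij (part_ge0 p) (fun _ => id) erefl.
by rewrite -addeA -EFinD => /addIe_fin.
Qed.

Lemma part_sum_id_split_seq i u p : 0 <= u <= 1 ->
  part_sum id (split_seq i u p) = part_sum id p.
Proof.
move=> u01; have := @part_sum_split_seq id i u p u01 (part_ge0 p) (fun _ => id).
rewrite -[RHS]addeA -EFinD (_ : id (u * p i) + id ((1 - u) * p i) = p i).
  exact: addIe_fin.
by rewrite /=; ring.
Qed.

Lemma part_sum_merge phi i j p : i != j ->
  (forall x, 0 <= x -> 0 <= phi x) -> phi 0 = 0 ->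
  (part_sum phi (merge_parts i j p) + (phi (p i))%:E + (phi (p j))%:E =
   part_sum phi p + (phi (p i + p j))%:E)%E.
Proof.
move=> ij phi0 phi00; rewrite -part_sum_merge_seq//; last exact: part_ge0.
rewrite [X in (X + _ + _)%E]part_sum_rearrange//; first exact/merge_seq_ge0/part_ge0.
by rewrite part_sum_id_merge_seq//; have [] := mass_partitionP p.
Qed.

Lemma part_sum_split phi i u p : 0 <= u <= 1 ->
  (forall x, 0 <= x -> 0 <= phi x) -> phi 0 = 0 ->
  (part_sum phi (split_part i u p) + (phi (p i))%:E =
   part_sum phi p + (phi (u * p i))%:E + (phi ((1 - u) * p i))%:E)%E.
Proof.
move=> u01 phi0 phi00; rewrite -part_sum_split_seq//; last exact: part_ge0.
rewrite [X in (X + _)%E]part_sum_rearrange//.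
  by apply: split_seq_ge0 => //; exact: part_ge0.
by rewrite part_sum_id_split_seq//; have [] := mass_partitionP p.
Qed.

Lemma merge_same_parts i j p : i != j ->
  same_parts (merge_parts i j p) (merge_seq i j p).
Proof.
move=> ij; apply: rearrangeP; first exact/merge_seq_ge0/part_ge0.
by rewrite part_sum_id_merge_seq//; have [] := mass_partitionP p.
Qed.

Lemma split_same_parts i u p : 0 <= u <= 1 ->
  same_parts (split_part i u p) (split_seq i u p).
Proof.
move=> u01; apply: rearrangeP; first exact/split_seq_ge0/part_ge0.
by rewrite part_sum_id_split_seq//; have [] := mass_partitionP p.
Qed.

Lemma same_parts_ex (q r : nat -> R) i : same_parts q r -> 0 < r i ->
  exists k, q k = r i.
Proof.
move=> /(_ (r i)) qr /[dup] ri /qr; rewrite card_eq_sym => /card_set_bijP[f [+ _ _]].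
by move=> /(_ i erefl); exists (f i).
Qed.

End moves.

Section measurability.
Context (R : realType).
Implicit Types (p q : mass_partition R) (phi : R -> R) (x y : R).

(** Measurability into this sigma-algebra is checked coordinate by coordinate.
    Being contained in the Borel one, it is rich enough to evaluate the kernel
    on all the sets that matter. *)
Definition coord_sets : set (set (mass_partition R)) :=
  [set A | exists k (B : set R), measurable B /\ A = (fun p => p k) @^-1` B].

Local Notation state := (g_sigma_algebraType coord_sets).

Lemma measurable_part k : measurable_fun [set: state] (fun p : mass_partition R => p k).
Proof.
move=> _ B mB; rewrite setTI; apply: sub_sigma_algebra; by exists k, B.
Qed.

Lemma measurable_to_state d (T : measurableType d) (h : T -> mass_partition R) :
  (forall k, measurable_fun setT (fun t => h t k)) ->
  measurable_fun setT (h : T -> state).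
Proof.
move=> mh; apply: (@measurability _ _ T state setT h coord_sets erefl) => _ [_ [k [B [mB
  ->]]] <-].
exact: mh.
Qed.

Lemma coord_measurable_borel (A : set (mass_partition R)) :
  (measurable : set (set state)) A -> measurable A.
Proof.
have : measurable_fun [set: mass_partition R] (id : mass_partition R -> state).
  apply: measurable_to_state => k.
  apply: (measurability _ (RGenOInfty.measurableE R)) => _ [_ [x ->] <-].
  apply: sub_sigma_algebra; rewrite setTI.
  apply: (@open_comp _ _ (fun p : mass_partition R => p k)); last by rewrite set_itvE;
    exact: open_gt.
  move=> p _; apply: (@continuous_comp _ _ _ (set_val : mass_partition R -> {ptws nat ->
    R}) (fun f => f k)).
    exact: initial_continuous.
  exact: (@proj_continuous nat (fun=> R) k).
by move=> id_m mA; have := id_m measurableT _ mA; rewrite setTI.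
Qed.

Lemma measurable_part_sum d (T : measurableType d) phi (r : T -> nat -> R) :
  measurable_fun setT phi -> (forall x, 0 <= x -> 0 <= phi x) ->
  (forall t i, 0 <= r t i) -> (forall i, measurable_fun setT (fun t => r t i)) ->
  measurable_fun setT (fun t => part_sum phi (r t)).
Proof.
move=> mphi phi0 r0 mr.
apply: (@ge0_emeasurable_sum _ _ _ _ (fun i t => (phi (r t i))%:E) xpredT).
  by move=> i t _ _; rewrite lee_fin phi0.
by move=> i _; apply/measurable_EFinP; exact: measurableT_comp.
Qed.

Lemma measurable_step y : measurable_fun setT (fun x : R => (y < x)%R%:R : R).
Proof.
rewrite (_ : (fun x => _) = \1_(`]y, +oo[)) ?measurable_indic//.
by apply/funext => x; rewrite indicE mem_setE in_itv/= andbT.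
Qed.

(** As [q] is nonincreasing, its [k]-th term exceeds [y] when more than [k] terms
    do.  This expresses the coordinates of a rearrangement through symmetric
    sums of the original sequence, which are visibly measurable. *)
Lemma part_gt q k y : 0 <= y ->
  (y < q k) = ((k.+1%:R)%:E <= part_sum (fun x => (y < x)%R%:R) q)%E.
Proof.
move=> y0.
have h i : (0 <= ((y < q i)%R%:R : R)%:E)%E by rewrite lee_fin.
rewrite /part_sum; case: ltP => qk; apply/esym.
  apply: le_trans (nneseries_lim_ge k.+1 _); last by [].
  rewrite big_mkord (eq_bigr (fun=> 1%E)).
    by rewrite sumEFin sumr_const card_ord.
  by move=> i _; rewrite (lt_le_trans qk)// part_noninc// -ltnS.
apply/negbTE; rewrite -ltNge.
rewrite (nneseries_split 0 k)// add0n [X in (_ + X)%E]eseries0 ?adde0.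
  rewrite sumEFin lte_fin.
  apply: (@le_lt_trans _ _ (\sum_(0 <= i < k) 1)).
    by apply: ler_sum => i _; rewrite lern1 leq_b1.
  by rewrite big_mkord sumr_const card_ord ltr_nat.
move=> i ki _; rewrite ltNge (le_trans _ qk)// part_noninc//.
Qed.

Lemma measurable_rearrange d (T : measurableType d) (r : T -> nat -> R) :
  (forall t i, 0 <= r t i) -> (forall t, part_sum id (r t) <= 1)%E ->
  (forall i, measurable_fun setT (fun t => r t i)) ->
  measurable_fun setT ((fun t => rearrange (r t)) : T -> state).
Proof.
move=> r0 r1 mr; apply: measurable_to_state => k.
apply: (measurability _ (RGenOInfty.measurableE R)) => // _ [_ [y ->] <-].
rewrite setTI; have [y0|y0] := leP 0 y; last first.
  rewrite [X in measurable X](_ : _ = setT)//.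
  apply/seteqP; split=> // t _ /=; rewrite in_itv/= andbT.
  exact/(lt_le_trans y0)/part_ge0.
rewrite [X in measurable X](_ : _ = setT `&`
    [set t | ((k.+1%:R)%:E <= part_sum (fun x => (y < x)%R%:R) (r t))%E]).
  apply: emeasurable_fun_c_infty => //.
  apply: measurable_part_sum => //; exact: measurable_step.
rewrite setTI; apply/funext => t /=; rewrite in_itv/= andbT part_gt//.
by rewrite part_sum_rearrange// ltNge y0.
Qed.

End measurability.

(** * Nonnegative functions as series of indicators *)

Section harmonic_decomposition.
Context d (T : measurableType d) (R : realType) (f : T -> \bar R).
Hypotheses (f0 : forall x, (0 <= f x)%E) (mf : measurable_fun setT f).

Let greedy : nat -> T -> R := fix s k x := if k is k'.+1 then
  s k' x + (if ((s k' x + harmonic k')%:E <= f x)%E then harmonic k' else 0) else 0.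

Let layer k := [set x | ((greedy k x + harmonic k)%:E <= f x)%E].

Let greedyS k x : greedy k.+1 x = greedy k x + harmonic k * \1_(layer k) x.
Proof.
rewrite /= indicE; case: ifPn => h.
  by rewrite mem_set// mulr1.
by rewrite memNset ?mulr0//; exact/negP.
Qed.

Let greedy_sum k x : greedy k x = \sum_(0 <= i < k) harmonic i * \1_(layer i) x.
Proof.
elim: k => [|k IH]; first by rewrite big_nil.
by rewrite big_nat_recr//= -IH -greedyS.
Qed.

Let measurable_layer k : measurable (layer k).
Proof.
have mg : measurable_fun setT (greedy k).
  elim: k => [|k mg]; first exact: measurable_cst.
  rewrite (_ : greedy k.+1 = (fun x => greedy k x + harmonic k * \1_(layer k) x));
    last first.
    by apply/funext => x; rewrite greedyS.
  apply: measurable_funD => //; apply: measurable_funM => //; apply: measurable_indic.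
  rewrite -[layer k]setTI; apply: measurable_lee => //.
  by apply/measurable_EFinP; apply: measurable_funD.
rewrite -[layer k]setTI; apply: measurable_lee => //.
by apply/measurable_EFinP; apply: measurable_funD.
Qed.

Let greedy_le k x : ((greedy k x)%:E <= f x)%E.
Proof.
elim: k => [|k IH] //=; case: ifPn => // _; by rewrite addr0.
Qed.

(** The harmonic weights tend to 0 but have infinite sum, so greedily adding the
    layers on which the next weight still fits exhausts [f].  Identities that are
    countably additive in [f] thus need to be checked on indicators only. *)
Lemma ge0_measurable_indic_series : exists2 B : nat -> set T,
  (forall k, measurable (B k)) &
  forall x, f x = (\sum_(0 <= k <oo) (harmonic k * \1_(B k) x)%:E)%E.
Proof.
exists layer => // x.
have a0 k : (0 <= (harmonic k * \1_(layer k) x : R)%:E)%E.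
  by rewrite lee_fin mulr_ge0// ?harmonic_ge0.
apply/eqP; rewrite eq_le; apply/andP; split; last first.
  apply: lime_le; first by apply: is_cvg_nneseries => n _ _; exact: a0.
  by apply: nearW => k; rewrite sumEFin -greedy_sum; exact: greedy_le.
rewrite leNgt; apply/negP.
set S := (\sum_(0 <= k <oo) _)%E => Sf.
have S0 : (0 <= S)%E by apply: nneseries_ge0 => n _ _; exact: a0.
have SE : S = (fine S)%:E by rewrite fineK// ge0_fin_numE// (lt_le_trans Sf)// leey.
have gS k : greedy k x <= fine S.
  by rewrite -lee_fin -SE greedy_sum -sumEFin; apply: nneseries_lim_ge => n _ _;
    exact: a0.
have [e e0 ef] : exists2 e : R, 0 < e & ((fine S + e)%:E <= f x)%E.
  move: Sf; rewrite SE; move: (f x) => [v| |]//.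
    rewrite lte_fin => Sv; exists (v - fine S); first by rewrite subr_gt0.
    by rewrite lee_fin addrC subrK.
  by exists 1; rewrite ?leey.
have [k0 _ hk0] : \forall k \near \oo, (harmonic k : R) < e.
  exact: near_infty_natSinv_lt (PosNum e0).
have inl k : (k0 <= k)%N -> \1_(layer k) x = 1 :> R.
  move=> /hk0 /= ke; rewrite indicE mem_set//.
  by apply: le_trans ef; rewrite lee_fin lerD// ltW.
(* all but the first [k0] harmonic weights are used at [x] *)
have bd n : \sum_(0 <= i < n) (harmonic i : R) <= k0%:R + fine S.
  apply: (@le_trans _ _ (\sum_(0 <= i < n) ((i < k0)%N%:R + harmonic i * \1_(layer i)
    x))).
    apply: ler_sum => i _; case: ltnP => ik; last by rewrite inl// mulr1 add0r.
    apply: (@le_trans _ _ 1); last by rewrite lerDl mulr_ge0// harmonic_ge0.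
    by rewrite invf_le1 ?ler1n// ltr0n.
  rewrite big_split/=; apply: lerD; last by rewrite -greedy_sum.
  rewrite -natr_sum ler_nat.
  elim: n => [|n IH]; first by rewrite big_nil.
  rewrite big_nat_recr//=; case: ltnP => nk; last by rewrite addn0.
  have le_n : forall m, (\sum_(0 <= i < m) (i < k0)%N <= m)%N.
    elim=> [|m IHm]; first by rewrite big_nil.
    by rewrite big_nat_recr//= -addn1 leq_add// leq_b1.
  by rewrite addn1; apply: leq_trans nk; rewrite ltnS le_n.
apply: (@dvg_harmonic R); apply: nondecreasing_is_cvgn.
  by apply: nondecreasing_series => n _ _; exact: harmonic_ge0.
by exists (k0%:R + fine S) => _ [n _ <-]; exact: bd.
Qed.

End harmonic_decomposition.

(** * The kernel as an operator on functions *)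

Section kernel_operator.
Context (R : realType) (sigma : probability R R) (bm bs : R).
Hypotheses (bm01 : 0 < bm <= 1) (bs01 : 0 < bs <= 1).
Implicit Types (p q : mass_partition R) (f : mass_partition R -> \bar R) (u : R).

Local Notation state := (g_sigma_algebraType (@coord_sets R)).
Local Notation I := (`]0, 2^-1%R]%classic : set R).

(** The probability of not moving. *)
Definition hold_rate p : R := 1 - bm * mass p ^+ 2 + (bm - bs) * sqnorm p.

(** The kernel acting on a function instead of a set.  The sum over pairs is an
    iterated series, to which the results on monotone exchange of series apply. *)
Definition kernel_op f p : \bar R :=
  ((2 * bm)%:E *
     (\sum_(0 <= i <oo) \sum_(0 <= j <oo | (i < j)%N)
        ((p i * p j)%:E * f (merge_parts i j p)))
   + bs%:E * (\sum_(0 <= i <oo)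
        ((p i ^+ 2)%:E * (\int[sigma]_(u in I) f (split_part i u p))))
   + (hold_rate p)%:E * f p)%E.

Lemma split_merge_kernelE p (A : set (mass_partition R)) :
  split_merge_kernel sigma bm bs p A = kernel_op (fun q => \d_q A) p.
Proof.
rewrite /split_merge_kernel /kernel_op; congr (_ * _ + _ + _)%E.
rewrite nneseries_esumT; last first.
  move=> i; apply: nneseries_ge0 => j _ _.
  by rewrite mule_ge0// lee_fin mulr_ge0 ?part_ge0.
under [RHS]eq_esum => i _.
  rewrite nneseries_esum; last first.
    by move=> j _; rewrite mule_ge0// lee_fin mulr_ge0 ?part_ge0.
  over.
rewrite esum_esum; last first.
  by move=> i j _ _; rewrite mule_ge0// lee_fin mulr_ge0 ?part_ge0.
by congr (esum _ _); apply/seteqP; split=> -[i j]//= [].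
Qed.

(** For [u] outside of [0, 1] the split sequence may be negative; clamping makes
    the split jointly measurable on the whole product space. *)
Definition clamp u : R := Num.max 0 (Num.min 1 u).

Lemma clamp01 u : 0 <= clamp u <= 1.
Proof. by rewrite /clamp le_max lexx ge_max ler01 ge_min lexx. Qed.

Lemma clamp_id u : 0 <= u <= 1 -> clamp u = u.
Proof. by move=> /andP[u0 u1]; rewrite /clamp (min_idPr u1) (max_idPr u0). Qed.

Lemma in_half u : I u -> [/\ 0 < u, u <= 2^-1 & 0 <= u <= 1].
Proof.
rewrite /= in_itv/= => /andP[u0 u1]; split=> //; rewrite ltW//= (le_trans u1)//.
by lra.
Qed.

Lemma measurable_merge i j : i != j ->
  measurable_fun [set: state] (merge_parts i j : state -> state).
Proof.
move=> ij; apply: measurable_rearrange.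
- by move=> p k; exact/merge_seq_ge0/part_ge0.
- by move=> p; rewrite part_sum_id_merge_seq//; have [] := mass_partitionP p.
- move=> k; case: (k == i); first by apply: measurable_funD; exact: measurable_part.
  by case: (k == j); [exact: measurable_cst|exact: measurable_part].
Qed.

Lemma measurable_split i : measurable_fun [set: state * R]
  ((fun pu => split_part i (clamp pu.2) pu.1) : state * R -> state).
Proof.
have mp k : measurable_fun setT (fun pu : state * R => parts pu.1 k).
  by apply: (measurableT_comp (measurable_part k)).
have mc : measurable_fun setT (fun pu : state * R => clamp pu.2).
  by apply: measurable_maxr => //; apply: measurable_minr.
apply: measurable_rearrange.
- by move=> pu k; apply: (@split_seq_ge0 R i) => [|l]; [exact: clamp01|exact: part_ge0].
- move=> pu; rewrite part_sum_id_split_seq ?clamp01//.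
  by have [] := mass_partitionP (pu.1 : mass_partition R).
- case=> [|k]; first by apply: measurable_funM => //; apply: measurable_funB.
  by case: (k == i) => //; apply: measurable_funM.
Qed.

Lemma integral_split_clamp f i p :
  (\int[sigma]_(u in I) f (split_part i u p) =
   \int[sigma]_(u in I) f (split_part i (clamp u) p))%E.
Proof.
by apply: eq_integral => u; rewrite inE => /in_half[_ _ u01]; rewrite clamp_id.
Qed.

Lemma measurable_split_u f i p : measurable_fun [set: state] f ->
  measurable_fun setT (fun u => f (split_part i (clamp u) p)).
Proof.
move=> mf; have mfs := measurableT_comp mf (measurable_split i).
exact: (measurableT_comp mfs (@pair1_measurable _ _ state R p)).
Qed.

Lemma measurable_mass : measurable_fun [set: state] (@mass R).
Proof.
apply: measurableT_comp => //.
apply: (@measurable_part_sum R _ state id (fun p : mass_partition R => parts p)) => //.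
  exact: part_ge0.
exact: measurable_part.
Qed.

Lemma measurable_sqnorm : measurable_fun [set: state] (@sqnorm R).
Proof.
apply: measurableT_comp => //.
apply: (@measurable_part_sum R _ state (fun x => x ^+ 2) (fun p : mass_partition R =>
  parts p)) => //.
- by move=> x x0; rewrite exprn_ge0.
- exact: part_ge0.
- exact: measurable_part.
Qed.

Lemma massE p : (mass p)%:E = part_sum id p.
Proof.
rewrite fineK// ge0_fin_numE.
  by have [_ _ p1] := mass_partitionP p; exact: le_lt_trans p1 (ltry _).
by apply: (@part_sum_ge0 _ id) => //; exact: part_ge0.
Qed.

Lemma part_le_mass p i : p i <= mass p.
Proof.
rewrite -lee_fin massE /part_sum (nneseriesD1 (n := i))//; last first.
  by move=> k _; rewrite lee_fin part_ge0.
by rewrite leeDl// nneseries_ge0// => k _ _; rewrite lee_fin part_ge0.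
Qed.

Lemma mass_le1 p : mass p <= 1.
Proof. by rewrite -lee_fin massE; have [] := mass_partitionP p. Qed.

Lemma mass_ge0 p : 0 <= mass p.
Proof. by rewrite -lee_fin massE part_sum_ge0//; exact: part_ge0. Qed.

(** Each square is at most the part times the total mass. *)
Lemma sqnormE p : (sqnorm p)%:E = part_sum (fun x => x ^+ 2) p /\
  sqnorm p <= mass p ^+ 2.
Proof.
have h : (part_sum (fun x => x ^+ 2)%R p <= (mass p ^+ 2)%:E)%E.
  rewrite expr2 EFinM {2}massE /part_sum -nneseriesZl; last by move=> i _;
    rewrite lee_fin part_ge0.
  apply: lee_nneseries => [i _ _|i _]; first by rewrite lee_fin exprn_ge0// part_ge0.
  by rewrite -EFinM lee_fin expr2 ler_wpM2r ?part_ge0// part_le_mass.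
have e : (sqnorm p)%:E = part_sum (fun x => x ^+ 2) p.
  rewrite fineK// ge0_fin_numE.
    exact: le_lt_trans h (ltry _).
  apply: (@part_sum_ge0 R (fun x : R => x ^+ 2)) => [|x _]; first exact: part_ge0.
  by rewrite exprn_even_ge0.
by split=> //; rewrite -lee_fin e.
Qed.

(** This is [1 - bm (mass^2 - Q) - bs Q], and both coefficients are at most 1
    while [0 <= Q <= mass^2 <= 1]. *)
Lemma hold_rate_ge0 p : 0 <= hold_rate p.
Proof.
have [_ Q] := sqnormE p; have m1 := mass_le1 p; have m0 := mass_ge0 p.
have Q0 : 0 <= sqnorm p.
  rewrite -lee_fin (sqnormE p).1 part_sum_ge0//; first exact: part_ge0.
  by move=> x _; rewrite exprn_even_ge0.
case/andP: bm01 => ? ?; case/andP: bs01 => ? ?.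
have : mass p ^+ 2 <= 1 by rewrite exprn_ile1.
rewrite /hold_rate; nra.
Qed.

Lemma split_integral_ge0 f i p : (forall q, (0 <= f q)%E) ->
  (0 <= \int[sigma]_(u in I) f (split_part i u p))%E.
Proof. by move=> f0; apply: integral_ge0. Qed.

Lemma kernel_op_nneseries (f : nat -> mass_partition R -> \bar R) p :
  (forall k q, (0 <= f k q)%E) -> (forall k, measurable_fun [set: state] (f k)) ->
  (kernel_op (fun q => \sum_(0 <= k <oo) f k q) p = \sum_(0 <= k <oo) kernel_op (f k)
    p)%E.
Proof.
move=> f0 mf; rewrite /kernel_op.
have pp i j : (0 <= (p i * p j)%:E)%E by rewrite lee_fin mulr_ge0// part_ge0.
have p2 i : (0 <= (p i ^+ 2)%:E)%E by rewrite lee_fin exprn_ge0// part_ge0.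
have bm0 : (0 <= (2 * bm)%:E)%E by rewrite lee_fin; case/andP: bm01 => *; lra.
have bs0 : (0 <= bs%:E)%E by rewrite lee_fin; case/andP: bs01 => *; lra.
have h0 : (0 <= (hold_rate p)%:E)%E by rewrite lee_fin hold_rate_ge0.
have i0 k i := split_integral_ge0 i p (f0 k).
rewrite nneseriesD => [|k _ _|k _ _]; last 2 first.
- apply: adde_ge0; apply: mule_ge0 => //; apply: nneseries_ge0 => i _ _.
    by apply: nneseries_ge0 => j _ _; rewrite mule_ge0.
  by rewrite mule_ge0.
- by rewrite mule_ge0.
rewrite nneseriesZl//; congr (_ + _)%E.
rewrite nneseriesD => [|k _ _|k _ _]; last 2 first.
- apply: mule_ge0 => //; apply: nneseries_ge0 => i _ _.
    by apply: nneseries_ge0 => j _ _; rewrite mule_ge0.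
- apply: mule_ge0 => //; apply: nneseries_ge0 => i _ _.
  by rewrite mule_ge0.
congr (_ + _)%E.
  rewrite nneseriesZl; last first.
    move=> k _; apply: nneseries_ge0 => i _ _.
    by apply: nneseries_ge0 => j _ _; rewrite mule_ge0.
  congr (_ * _)%E; rewrite nneseries_interchange; last first.
    by move=> k i; apply: nneseries_ge0 => j _ _; rewrite mule_ge0.
  apply: eq_eseriesr => i _.
  rewrite [RHS]nneseries_interchange; last by move=> k j; rewrite mule_ge0.
  by apply: eq_eseriesr => j _; rewrite nneseriesZl.
rewrite nneseriesZl; last first.
  by move=> k _; apply: nneseries_ge0 => i _ _; rewrite mule_ge0.
congr (_ * _)%E; rewrite nneseries_interchange; last by move=> k i; rewrite mule_ge0.
apply: eq_eseriesr => i _; rewrite nneseriesZl//; congr (_ * _)%E.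
under [RHS]eq_eseriesr do rewrite integral_split_clamp.
rewrite (integral_split_clamp (fun q => \sum_(0 <= k <oo) f k q)%E) integral_nneseries//.
move=> k; apply: measurable_funTS; exact: measurable_split_u.
Qed.

Lemma kernel_opZ f (c : R) p : 0 <= c -> (forall q, (0 <= f q)%E) ->
  measurable_fun [set: state] f ->
  kernel_op (fun q => c%:E * f q)%E p = (c%:E * kernel_op f p)%E.
Proof.
move=> c0 f0 mf; rewrite /kernel_op.
have pp i j : (0 <= (p i * p j)%:E)%E by rewrite lee_fin mulr_ge0// part_ge0.
have p2 i : (0 <= (p i ^+ 2)%:E)%E by rewrite lee_fin exprn_ge0// part_ge0.
have bm0 : (0 <= (2 * bm)%:E)%E by rewrite lee_fin; case/andP: bm01 => *; lra.
have bs0 : (0 <= bs%:E)%E by rewrite lee_fin; case/andP: bs01 => *; lra.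
have h0 : (0 <= (hold_rate p)%:E)%E by rewrite lee_fin hold_rate_ge0.
have i0 i := split_integral_ge0 i p f0.
have s1 : (0 <= \sum_(0 <= i <oo) \sum_(0 <= j <oo | (i < j)%N)
        ((p i * p j)%:E * f (merge_parts i j p)))%E.
  by apply: nneseries_ge0 => i _ _; apply: nneseries_ge0 => j _ _; rewrite mule_ge0.
have s2 : (0 <= \sum_(0 <= i <oo)
        ((p i ^+ 2)%:E * (\int[sigma]_(u in I) f (split_part i u p))))%E.
  by apply: nneseries_ge0 => i _ _; rewrite mule_ge0.
rewrite !ge0_muleDr ?adde_ge0 ?mule_ge0//; congr (_ + _ + _)%E; last first.
- by rewrite muleCA.
- rewrite [RHS]muleCA; congr (_ * _)%E; rewrite -nneseriesZl; last by move=> i _;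
  rewrite mule_ge0.
  apply: eq_eseriesr => i _; rewrite [RHS]muleCA; congr (_ * _)%E.
  rewrite [in RHS]integral_split_clamp -ge0_integralZl_EFin//.
    by rewrite -(integral_split_clamp (fun q => c%:E * f q)%E).
  by apply: measurable_funTS; exact: measurable_split_u.
- rewrite [RHS]muleCA; congr (_ * _)%E; rewrite -nneseriesZl; last first.
    by move=> i _; apply: nneseries_ge0 => j _ _; rewrite mule_ge0.
  apply: eq_eseriesr => i _; rewrite -nneseriesZl; last by move=> j _; rewrite mule_ge0.
  by apply: eq_eseriesr => j _; rewrite muleCA.
Qed.

Lemma kernel_op_ge0 f p : (forall q, (0 <= f q)%E) -> (0 <= kernel_op f p)%E.
Proof.
move=> f0.
have pp i j : (0 <= (p i * p j)%:E)%E by rewrite lee_fin mulr_ge0// part_ge0.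
rewrite /kernel_op !adde_ge0 ?mule_ge0//.
- by rewrite lee_fin; case/andP: bm01 => *; lra.
- by apply: nneseries_ge0 => i _ _; apply: nneseries_ge0 => j _ _; rewrite mule_ge0.
- by rewrite lee_fin; case/andP: bs01 => *; lra.
- apply: nneseries_ge0 => i _ _; rewrite mule_ge0//; last exact: split_integral_ge0.
  by rewrite lee_fin exprn_ge0// part_ge0.
- by rewrite lee_fin hold_rate_ge0.
Qed.

Lemma measurable_kernel_op f : (forall q, (0 <= f q)%E) ->
  measurable_fun [set: state] f -> measurable_fun [set: state] (kernel_op f).
Proof.
move=> f0 mf.
have mp k := @measurable_part R k.
have pp p i j : (0 <= (p i * p j)%:E)%E by rewrite lee_fin mulr_ge0// part_ge0.
apply: emeasurable_funD; first apply: emeasurable_funD.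
- apply: emeasurable_funM => //.
  apply: (@ge0_emeasurable_sum _ state R setT (fun i p => \sum_(0 <= j <oo | (i < j)%N)
        ((parts p i * parts p j)%:E * f (merge_parts i j p)))%E xpredT) => [i p _ _|i _].
    by apply: nneseries_ge0 => j _ _; rewrite mule_ge0.
  apply: (@ge0_emeasurable_sum _ state R setT (fun j p => 
        ((parts p i * parts p j)%:E * f (merge_parts i j p)))%E (fun j => (i < j)%N)) =>
          [j p _ _|j ij].
    by rewrite mule_ge0.
  apply: emeasurable_funM; first by apply/measurable_EFinP; apply: measurable_funM.
  by apply: (measurableT_comp mf); apply: measurable_merge; rewrite ltn_eqF.
- apply: emeasurable_funM => //.
  apply: (@ge0_emeasurable_sum _ state R setT (fun i p => ((parts p i ^+ 2)%:E *
     (\int[sigma]_(u in I) f (split_part i u p))))%E xpredT) => [i p _ _|i _].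
    by rewrite mule_ge0 ?split_integral_ge0// lee_fin exprn_ge0// part_ge0.
  apply: emeasurable_funM; first by apply/measurable_EFinP; apply: measurable_funX.
  rewrite (_ : (fun p => _) = fubini_F sigma
    (fun pu : state * R => (f (split_part i (clamp pu.2) pu.1) * (\1_I pu.2)%:E)%E)).
    apply: measurable_fun_fubini_tonelli_F => [|pu]; last by rewrite mule_ge0// lee_fin.
    apply: emeasurable_funM; first exact: (measurableT_comp mf (measurable_split i)).
    by apply/measurable_EFinP; apply: measurableT_comp.
  apply/funext => p; rewrite integral_split_clamp integral_mkcond epatch_indic.
  by [].
- apply: emeasurable_funM => //; apply/measurable_EFinP.
  apply: measurable_funD; first apply: measurable_funB => //.
    by apply: measurable_funM => //; apply: measurable_funX; exact: measurable_mass.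
  by apply: measurable_funM => //; exact: measurable_sqnorm.
Qed.

End kernel_operator.

Section chain_step.
Context (R : realType) (sigma : probability R R) (bm bs : R).
Hypotheses (bm01 : 0 < bm <= 1) (bs01 : 0 < bs <= 1).
Context (d : measure_display) (T : measurableType d) (P : probability T R)
    (X : nat -> T -> mass_partition R).
Hypothesis chainX : markov_chain (split_merge_kernel sigma bm bs) unit_partition P X.
Local Notation state := (g_sigma_algebraType (@coord_sets R)).
Local Notation K := (kernel_op sigma bm bs).

Lemma measurable_chain n : measurable_fun setT (X n : T -> state).
Proof.
have [mX _ _] := chainX.
by move=> _ A mA; apply: mX => //; exact: coord_measurable_borel.
Qed.

Lemma history_measurable n F : history X n F -> measurable F.
Proof.
have [mX _ _] := chainX.
apply: smallest_sub; first exact: sigma_algebra_measurable.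
by move=> _ [k [B [_ mB ->]]]; rewrite -[_ @^-1` _]setTI; exact: mX.
Qed.

(** The Markov property is the case of indicators, and both sides are countably
    additive in [f]. *)
Lemma chain_step n F (f : mass_partition R -> \bar R) : history X n F ->
  (forall q, (0 <= f q)%E) -> measurable_fun [set: state] f ->
  (\int[P]_(w in F) f (X n.+1 w) = \int[P]_(w in F) K f (X n w))%E.
Proof.
move=> hF f0 mf; have mF := history_measurable hF.
have [B mB fE] := @ge0_measurable_indic_series _ state R f f0 mf.
have e0 k q : (0 <= (\1_(B k) q : R)%:E)%E by rewrite lee_fin.
have me k : measurable_fun [set: state] (fun q : mass_partition R => (\1_(B k) q : R)%:E).
  by apply/measurable_EFinP; exact: measurable_indic.
pose g k q : \bar R := ((harmonic k : R)%:E * (\1_(B k) q)%:E)%E.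
have g0 k q : (0 <= g k q)%E by rewrite mule_ge0// lee_fin harmonic_ge0.
have mg k : measurable_fun [set: state] (g k) by exact: emeasurable_funM.
have -> : f = (fun q => \sum_(0 <= k <oo) g k q)%E.
  by apply/funext => q; rewrite fE; apply: eq_eseriesr.
rewrite integral_nneseries//; last first.
  by move=> k; apply: measurable_funTS; apply: (measurableT_comp (mg k));
    exact: measurable_chain.
under [RHS]eq_integral do rewrite kernel_op_nneseries//.
have mK h : (forall q, (0 <= h q)%E) -> measurable_fun [set: state] h ->
    measurable_fun F (fun w => K h (X n w)).
  move=> h0 mh; apply: measurable_funTS.
  exact: (measurableT_comp (measurable_kernel_op sigma bm bs h0 mh) (measurable_chain n)).
rewrite integral_nneseries//; last 2 first.
- by move=> k; exact: mK.
- by move=> k w _; exact: kernel_op_ge0.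
apply: eq_eseriesr => k _.
under [RHS]eq_integral do rewrite kernel_opZ ?harmonic_ge0//.
have mXB : measurable (X n.+1 @^-1` B k).
  by rewrite -[X in measurable X]setTI; exact: measurable_chain.
have mind : measurable_fun F (fun w => (\1_(B k) (X n.+1 w) : R)%:E).
  apply: measurable_funTS; exact: (measurableT_comp (me k) (measurable_chain n.+1)).
rewrite [LHS]ge0_integralZl_EFin ?harmonic_ge0//.
rewrite [RHS]ge0_integralZl_EFin ?harmonic_ge0//; last 2 first.
- by move=> w _; exact: kernel_op_ge0.
- exact: mK.
congr (_ * _)%E.
have [_ _ /(_ n F (B k) hF)] := chainX.
move=> /(_ (coord_measurable_borel (mB k))).
under [X in _ = X -> _]eq_integral do rewrite split_merge_kernelE.
move=> e; rewrite -[RHS]e setIC -integral_indic//.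
Qed.

End chain_step.

(** * Partitions with finitely many parts and unit mass *)

Section finite_partitions.
Context (R : realType).
Implicit Types (p q : mass_partition R) (phi : R -> R).
Local Notation state := (g_sigma_algebraType (@coord_sets R)).

(** As the parts are nonincreasing, [n] positive parts are the first [n]. *)
Definition finite_partition n p : Prop :=
  (forall i, (0 < p i) = (i < n)%N) /\ \sum_(i < n) p i = 1.

Definition proper_partition : set (mass_partition R) :=
  [set p | exists n, finite_partition n p].

Definition positive (x : R) : R := (0 < x)%R%:R.

Definition num_parts p : \bar R := part_sum positive p.

Lemma positive_ge0 x : 0 <= positive x. Proof. by []. Qed.

Lemma positive0 : positive 0 = 0. Proof. by rewrite /positive ltxx. Qed.

Lemma finite_partition0 n p i : finite_partition n p -> (n <= i)%N -> p i = 0.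
Proof.
move=> [pn _] ni; apply/eqP; rewrite eq_le part_ge0 andbT leNgt pn.
by rewrite -leqNgt.
Qed.

Lemma nneseries_finite (a : nat -> \bar R) n (Q : pred nat) :
  (forall i, (0 <= a i)%E) -> (forall i, (n <= i)%N -> a i = 0%E) ->
  (\sum_(0 <= i <oo | Q i) a i = \sum_(i < n | Q i) a i)%E.
Proof.
move=> a0 an; rewrite (nneseries_split_cond 0 n)// add0n [X in (_ + X)%E]eseries0.
  by rewrite adde0 big_mkord.
by move=> i ni _; exact: an.
Qed.

Lemma finite_part_sum n p phi : finite_partition n p ->
  (forall x, 0 <= x -> 0 <= phi x) -> phi 0 = 0 ->
  part_sum phi p = (\sum_(i < n) phi (p i))%:E.
Proof.
move=> pn phi0 phi00; rewrite /part_sum (@nneseries_finite _ n).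
- by rewrite sumEFin.
- by move=> i; rewrite lee_fin phi0// part_ge0.
- by move=> i ni; rewrite (finite_partition0 pn ni) phi00.
Qed.

Lemma finite_part_count n p : finite_partition n p ->
  part_sum positive p = n%:R%:E.
Proof.
move=> pn; rewrite (finite_part_sum pn)//; last exact: positive0.
rewrite (eq_bigr (fun=> 1)) ?sumr_const ?card_ord// => i _.
by rewrite /positive pn.1 ltn_ord.
Qed.

Lemma finite_part_mass n p : finite_partition n p -> part_sum id p = 1%E.
Proof. by move=> pn; rewrite (finite_part_sum pn)//= pn.2. Qed.

Lemma finite_partitionP n p : part_sum id p = 1%E ->
  part_sum positive p = n%:R%:E -> finite_partition n p.
Proof.
move=> p1 pn; have pos i : (0 < p i) = (i < n)%N.
  by rewrite part_gt// pn lee_fin ler_nat.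
split=> //; apply: EFin_inj; rewrite -[RHS]p1 -sumEFin /part_sum (@nneseries_finite _
  n)//.
- by move=> i; rewrite lee_fin part_ge0.
- move=> i ni; congr EFin; apply/eqP; rewrite eq_le part_ge0 andbT leNgt pos.
  by rewrite -leqNgt.
Qed.

(** Both conditions are symmetric functionals, hence stable under rearrangement
    and measurable. *)
Lemma proper_partitionP p : proper_partition p <->
  part_sum id p = 1%E /\ (part_sum positive p < +oo)%E.
Proof.
split=> [[n pn]|[p1 poo]].
  by rewrite (finite_part_mass pn) (finite_part_count pn) ltry.
have [n pn] : exists n, ~~ (0 < p n).
  apply: contrapT => /forallNP h.
  have : forall n, (n%:R%:E <= part_sum positive p)%E.
    case=> [|n]; first by rewrite part_sum_ge0//; exact: part_ge0.
    by rewrite -part_gt//; apply/negPn/negP/h.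
  move: poo; have : (0 <= part_sum positive p)%E by rewrite part_sum_ge0//;
    exact: part_ge0.
  case: (part_sum positive p) => [v| |]// v0 _ /(_ (Num.bound v)).
  rewrite lee_fin leNgt => /negP; apply; exact: archi_boundP.
have ex : exists n, ~~ (0 < p n) by exists n.
exists (ex_minn ex); case: ex_minnP => m pm minm.
have pos i : (0 < p i) = (i < m)%N.
  case: (ltnP i m) => im.
    by apply/negPn/negP => /minm; rewrite leqNgt im.
  apply/negbTE; rewrite -leNgt; apply: le_trans (part_noninc p im) _.
  by rewrite leNgt.
apply: finite_partitionP => //.
rewrite /part_sum (@nneseries_finite _ m).
- rewrite sumEFin (eq_bigr (fun=> 1)) ?sumr_const ?card_ord// => i _.
  by rewrite /positive pos ltn_ord.
- by move=> i; rewrite lee_fin positive_ge0.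
- by move=> i mi; rewrite /positive pos ltnNge mi.
Qed.

Lemma measurable_positive : measurable_fun setT positive.
Proof. exact: measurable_step. Qed.

Lemma measurable_state_sum phi : measurable_fun setT phi ->
  (forall x, 0 <= x -> 0 <= phi x) ->
  measurable_fun [set: state] (fun p : mass_partition R => part_sum phi p).
Proof.
move=> mphi phi0.
apply: (@measurable_part_sum R _ state phi (fun p : mass_partition R => parts p)) => //.
  exact: part_ge0.
exact: measurable_part.
Qed.

Lemma measurable_proper : measurable (proper_partition : set state).
Proof.
have m1 : measurable_fun [set: state] (fun p : mass_partition R => part_sum id p).
  exact: measurable_state_sum.
have mp : measurable_fun [set: state] (fun p : mass_partition R => part_sum positive p).
  by apply: measurable_state_sum => //; exact: measurable_positive.
have := measurableI _ _ (m1 measurableT [set 1%E] (emeasurable_set1 _))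
  (emeasurable_fun_infty_o measurableT mp +oo%E).
rewrite !setTI; congr measurable.
by apply/seteqP; split=> p /proper_partitionP.
Qed.

Lemma finite_merge n p i j : finite_partition n p ->
  (i < n)%N -> (j < n)%N -> i != j -> finite_partition n.-1 (merge_parts i j p).
Proof.
move=> pn ni nj ij; apply: finite_partitionP.
  have := @part_sum_merge R id i j p ij (fun _ => id) erefl.
  by rewrite -addeA -EFinD => /addIe_fin ->; exact: finite_part_mass pn.
have := @part_sum_merge R positive i j p ij (fun _ _ => positive_ge0 _) positive0.
rewrite (finite_part_count pn) -addeA -EFinD.
have [pi pj] : 0 < p i /\ 0 < p j by rewrite !pn.1.
rewrite /positive pi pj addr_gt0//.
rewrite (_ : (n%:R%:E + true%:R%:E)%E = ((n.-1)%:R%:E + (true%:R + true%:R)%:E)%E).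
  exact: addIe_fin.
by rewrite -!EFinD -!natrD; congr (_%:R%:E); rewrite !addn1 addn2 prednK//; case: (n) ni.
Qed.

Lemma finite_split n p i u : finite_partition n p ->
  (i < n)%N -> 0 < u < 1 -> finite_partition n.+1 (split_part i u p).
Proof.
move=> pn ni /andP[u0 u1]; have u01 : 0 <= u <= 1 by rewrite !ltW.
apply: finite_partitionP.
  have := @part_sum_split R id i u p u01 (fun _ => id) erefl.
  rewrite -[RHS]addeA -EFinD (_ : id (u * p i) + id ((1 - u) * p i) = p i).
    by move=> /addIe_fin ->; exact: finite_part_mass pn.
  by rewrite /=; ring.
have := @part_sum_split R positive i u p u01 (fun _ _ => positive_ge0 _) positive0.
rewrite (finite_part_count pn).
have pi : 0 < p i by rewrite pn.1.
rewrite /positive pi !mulr_gt0 ?subr_gt0// => /addIe_fin ->.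
by rewrite -EFinD -natrD addn1.
Qed.

Lemma finite_partition_gt0 n p : finite_partition n p -> (0 < n)%N.
Proof.
case: n => // -[_]; rewrite big_ord0 => /eqP; by rewrite eq_sym oner_eq0.
Qed.

Lemma finite_partition_le1 n p i : finite_partition n p -> p i <= 1.
Proof.
move=> pn; apply: le_trans (part_le_mass p i) _; exact: mass_le1.
Qed.

Lemma unit_finite : finite_partition 1 (@unit_partition R).
Proof.
split; first by case=> [|i]; rewrite /parts/= ?ltr01 ?ltxx.
by rewrite big_ord1.
Qed.

Lemma finite_partition1 p : finite_partition 1 p -> p = unit_partition.
Proof.
move=> p1; apply: mass_partition_inj => -[|i].
  by have := p1.2; rewrite big_ord1.
by rewrite (finite_partition0 p1)//.
Qed.

End finite_partitions.

Arguments proper_partition {R}.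

Section finite_kernel.
Context (R : realType) (sigma : probability R R) (bm bs : R).
Hypotheses (bm01 : 0 < bm <= 1) (bs01 : 0 < bs <= 1).
Variables (n : nat) (p : mass_partition R) (f : mass_partition R -> \bar R).
Hypotheses (pn : finite_partition n p) (f0 : forall q, (0 <= f q)%E).
Local Notation I := (`]0, 2^-1%R]%classic : set R).
Local Notation K := (kernel_op sigma bm bs).
Let Q := \sum_(i < n) p i ^+ 2.

Lemma finite_hold_rate : hold_rate bm bs p = 1 - bm + (bm - bs) * Q.
Proof.
have m1 : mass p = 1.
  by apply: EFin_inj; rewrite massE (finite_part_mass pn).
have -> : Q = sqnorm p.
  apply: EFin_inj; rewrite (sqnormE p).1 (finite_part_sum pn)//.
    by move=> x x0; rewrite exprn_ge0.
  by rewrite expr0n.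
by rewrite /hold_rate m1 expr1n mulr1.
Qed.

Lemma kernel_op_finite : (K f p =
  (2 * bm)%:E * (\sum_(i < n) \sum_(j < n | (i < j)%N)
        ((p i * p j)%:E * f (merge_parts i j p)))
   + bs%:E * (\sum_(i < n)
        ((p i ^+ 2)%:E * (\int[sigma]_(u in I) f (split_part i u p))))
   + (1 - bm + (bm - bs) * Q)%:E * f p)%E.
Proof.
have pp i j : (0 <= (p i * p j)%:E)%E by rewrite lee_fin mulr_ge0// part_ge0.
rewrite /kernel_op finite_hold_rate; congr (_ * _ + _ * _ + _)%E.
  rewrite (@nneseries_finite _ _ n).
  - apply: eq_bigr => i _; rewrite (@nneseries_finite _ _ n)//.
      by move=> j; rewrite mule_ge0.
    by move=> j nj; rewrite (finite_partition0 pn nj) mulr0 mul0e.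
  - by move=> i; apply: nneseries_ge0 => j _ _; rewrite mule_ge0.
  - move=> i ni; apply: eseries0 => j _ _.
    by rewrite (finite_partition0 pn ni) mul0r mul0e.
rewrite (@nneseries_finite _ _ n)//.
  move=> i; rewrite mule_ge0//; last exact: split_integral_ge0.
  by rewrite lee_fin exprn_ge0// part_ge0.
by move=> i ni; rewrite (finite_partition0 pn ni) expr0n mul0e.
Qed.

(** Twice the sum over pairs is the full double sum without its diagonal. *)
Lemma sum_lt_half (w : nat -> nat -> R) : (forall i j, w i j = w j i) ->
  2 * (\sum_(i < n) \sum_(j < n | (i < j)%N) w i j) =
  \sum_(i < n) \sum_(j < n) w i j - \sum_(i < n) w i i.
Proof.
move=> ws; apply/eqP; rewrite eq_sym subr_eq; apply/eqP.
have E : \sum_(i < n) \sum_(j < n) w i j =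
    \sum_(i < n) (\sum_(j < n | (i < j)%N) w i j + \sum_(j < n | (j < i)%N) w i j + w i
      i).
  apply: eq_bigr => i _; rewrite (bigID (fun j : 'I_n => (i < j)%N))/= -addrA;
    congr (_ + _).
  rewrite [RHS]addrC (bigD1 i) ?ltnn//=; congr (_ + _); apply: eq_bigl => j.
  by rewrite -leqNgt ltn_neqAle andbC.
rewrite E !big_split/= mulr2n mulrDl mul1r; congr (_ + _ + _).
rewrite (exchange_big_dep xpredT)//=; apply: eq_bigr => i _.
by apply: eq_bigr => j _.
Qed.

(** In the terms [x i] the sum over the other index is [1 - p i], because the
    parts add up to 1. *)
Lemma pair_rate_sum (a : R) (x : nat -> R) :
  2 * (\sum_(i < n) \sum_(j < n | (i < j)%N) (p i * p j) * (a + x i + x j)) =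
  a * (1 - Q) + 2 * \sum_(i < n) p i * (1 - p i) * x i.
Proof.
have [_ p1] := pn.
rewrite (@sum_lt_half (fun i j => (p i * p j) * (a + x i + x j))); last first.
  by move=> i j; rewrite [p j * p i]mulrC addrAC.
have -> : \sum_(i < n) \sum_(j < n) p i * p j * (a + x i + x j) =
    a + 2 * \sum_(i < n) p i * x i.
  transitivity (\sum_(i < n) (p i * a + p i * x i + p i * \sum_(j < n) p j * x j)).
    apply: eq_bigr => i _.
    transitivity (\sum_(j < n) ((p i * (a + x i)) * p j + p i * (p j * x j))).
      by apply: eq_bigr => j _; ring.
    by rewrite big_split/= -!mulr_sumr p1; ring.
  by rewrite !big_split/= -!mulr_suml p1; ring.
have -> : \sum_(i < n) p i * p i * (a + x i + x i) =
    a * Q + 2 * \sum_(i < n) p i ^+ 2 * x i.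
  rewrite /Q !mulr_sumr -big_split/=; apply: eq_bigr => i _; ring.
have -> : \sum_(i < n) p i * (1 - p i) * x i =
    \sum_(i < n) p i * x i - \sum_(i < n) p i ^+ 2 * x i.
  rewrite -sumrB; apply: eq_bigr => i _; ring.
ring.
Qed.

Variables (a c : R) (x b : nat -> R).

(** The value of [kernel_op] at [p] for a function equal to [a + x i + x j] after
    merging [i] and [j], to [b i] on average after splitting [i], and to [c] if
    nothing happens. *)
Definition drift_bound : R :=
  bm * (a * (1 - Q) + 2 * \sum_(i < n) p i * (1 - p i) * x i)
  + bs * (\sum_(i < n) p i ^+ 2 * b i) + (1 - bm + (bm - bs) * Q) * c.

Let drift_boundE : drift_bound%:E =
  ((2 * bm)%:E * (\sum_(i < n) \sum_(j < n | (i < j)%N)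
        ((p i * p j)%:E * (a + x i + x j)%:E))
   + bs%:E * (\sum_(i < n) ((p i ^+ 2)%:E * (b i)%:E))
   + (1 - bm + (bm - bs) * Q)%:E * c%:E)%E.
Proof.
rewrite /drift_bound -pair_rate_sum !EFinD !EFinM.
congr (_ + _ * _ + _ * _)%E.
  rewrite muleCA muleA -EFinM; congr (_ * _)%E.
  rewrite -sumEFin; apply: eq_bigr => i _; rewrite -sumEFin; apply: eq_bigr => j _.
  by rewrite !EFinM.
by rewrite -sumEFin; apply: eq_bigr => i _; rewrite EFinM.
Qed.

Let pp i j : (0 <= (p i * p j)%:E)%E.
Proof. by rewrite lee_fin mulr_ge0// part_ge0. Qed.
Let p2 i : (0 <= (p i ^+ 2)%:E)%E.
Proof. by rewrite lee_fin exprn_ge0// part_ge0. Qed.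
Let bm0 : (0 <= (2 * bm)%:E)%E.
Proof. by rewrite lee_fin; case/andP: bm01 => *; lra. Qed.
Let bs0 : (0 <= bs%:E)%E.
Proof. by rewrite lee_fin; case/andP: bs01 => *; lra. Qed.
Let h0 : (0 <= (1 - bm + (bm - bs) * Q)%:E)%E.
Proof. by rewrite -finite_hold_rate lee_fin hold_rate_ge0. Qed.

Lemma kernel_op_le :
  (forall i j, (i < j)%N -> (j < n)%N -> (f (merge_parts i j p) <= (a + x i + x j)%:E)%E)
    ->
  (forall i, (i < n)%N -> (\int[sigma]_(u in I) f (split_part i u p) <= (b i)%:E)%E) ->
  (f p <= c%:E)%E -> (K f p <= drift_bound%:E)%E.
Proof.
move=> fm fs fp; rewrite kernel_op_finite drift_boundE.
apply: leeD; first apply: leeD.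
- apply: lee_wpmul2l => //; apply: lee_sum => i _; apply: lee_sum => j ij.
  by apply: lee_wpmul2l => //; exact: fm.
- apply: lee_wpmul2l => //; apply: lee_sum => i _.
  by apply: lee_wpmul2l => //; exact: fs.
- exact: lee_wpmul2l.
Qed.

Lemma kernel_op_ge :
  (forall i j, (i < j)%N -> (j < n)%N -> ((a + x i + x j)%:E <= f (merge_parts i j p))%E)
    ->
  (forall i, (i < n)%N -> ((b i)%:E <= \int[sigma]_(u in I) f (split_part i u p))%E) ->
  (c%:E <= f p)%E -> (drift_bound%:E <= K f p)%E.
Proof.
move=> fm fs fp; rewrite kernel_op_finite drift_boundE.
apply: leeD; first apply: leeD.
- apply: lee_wpmul2l => //; apply: lee_sum => i _; apply: lee_sum => j ij.
  by apply: lee_wpmul2l => //; exact: fm.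
- apply: lee_wpmul2l => //; apply: lee_sum => i _.
  by apply: lee_wpmul2l => //; exact: fs.
- exact: lee_wpmul2l.
Qed.

End finite_kernel.

(** * Excursions from the one-part state *)

Section excursions.
Context (R : realType) (sigma : probability R R) (bm bs : R).
Hypotheses (bm01 : 0 < bm <= 1) (bs01 : 0 < bs <= 1).
Hypothesis sigma1 : sigma (`]0, 2^-1]%classic : set R) = 1%E.
Context (d : measure_display) (T : measurableType d) (P : probability T R)
    (X : nat -> T -> mass_partition R).
Hypothesis chainX : markov_chain (split_merge_kernel sigma bm bs) unit_partition P X.
Local Notation state := (g_sigma_algebraType (@coord_sets R)).
Local Notation K := (kernel_op sigma bm bs).
Local Notation I := (`]0, 2^-1%R]%classic : set R).
Local Notation unit := (@unit_partition R).

(** A part of size at least 1 exhausts the mass. *)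
Lemma unit_partitionP (p : mass_partition R) : 1 <= p 0%N -> p = unit.
Proof.
move=> p1; apply: finite_partition1.
have p0 : p 0%N = 1.
  by apply/eqP; rewrite eq_le p1 andbT (le_trans (part_le_mass p 0))// mass_le1.
have p_ i : p i.+1 = 0.
  have [_ _] := mass_partitionP p.
  rewrite /part_sum (nneseriesD1 (n := 0))//; last by move=> k _;
    rewrite lee_fin part_ge0.
  rewrite (nneseriesD1 (n := i.+1))//; last by move=> k _; rewrite lee_fin part_ge0.
  set S := (\sum_(_ <= _ <oo | _) _)%E.
  have S0 : (0 <= S)%E by apply: nneseries_ge0 => k _ _; rewrite lee_fin part_ge0.
  move=> h; have : ((p 0%N)%:E + (p i.+1)%:E <= 1)%E.
    by apply: le_trans h; rewrite leeD2l// leeDl.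
  rewrite -EFinD lee_fin p0 => h2; apply/eqP; rewrite eq_le part_ge0 andbT; lra.
split; last by rewrite big_ord1.
by case=> [|i]; rewrite ?p0 ?ltr01// p_ ltxx.
Qed.

Lemma measurable_unit : measurable ([set unit] : set state).
Proof.
have := @measurable_part R 0%N measurableT `[1, +oo[%classic (measurable_itv _).
rewrite setTI; congr measurable; apply/seteqP; split=> [p|p ->] /=.
  by rewrite in_itv/= andbT => /unit_partitionP.
by rewrite in_itv/= /parts/= lexx.
Qed.

(** The states visited strictly inside an excursion. *)
Definition away : set (mass_partition R) := proper_partition `\ unit.

Lemma measurable_away : measurable (away : set state).
Proof. by apply: measurableD; [exact: measurable_proper|exact: measurable_unit]. Qed.

Lemma history_preimage n k (B : set (mass_partition R)) : (k <= n)%N ->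
  measurable (B : set state) -> history X n (X k @^-1` B).
Proof.
move=> kn mB; apply: sub_sigma_algebra; exists k, B; split=> //.
exact: coord_measurable_borel.
Qed.

Lemma history_setI n F G : history X n F -> history X n G -> history X n (F `&` G).
Proof.
move=> hF hG.
exact: (@measurableI _ (g_sigma_algebraType [set F | exists k (B : set (mass_partition
  R)),
         [/\ (k <= n)%N, measurable B & F = X k @^-1` B]])).
Qed.

(** That the states are proper is part of the event: it only holds almost surely,
    and the drift estimates are only available there. *)
Fixpoint excursion n : set T :=
  if n is n'.+1 then excursion n' `&` X n @^-1` away else X 0 @^-1` [set unit].

Lemma history_mono n m F : (n <= m)%N -> history X n F -> history X m F.
Proof.
move=> nm; apply: smallest_sub; first exact: smallest_sigma_algebra.
move=> _ [k [B [kn mB ->]]]; apply: sub_sigma_algebra; exists k, B; split=> //.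
exact: leq_trans nm.
Qed.

Lemma history_excursion n : history X n (excursion n).
Proof.
elim: n => [|n IH] /=; first by apply: history_preimage => //; exact: measurable_unit.
apply: history_setI; first exact: history_mono IH.
by apply: history_preimage => //; exact: measurable_away.
Qed.

Lemma measurable_excursion n : measurable (excursion n).
Proof. exact (history_measurable chainX (@history_excursion n)). Qed.

Lemma excursion_proper n w : excursion n w -> proper_partition (X n w).
Proof.
by case: n => [/= ->|n [_ []]//]; exists 1%N; exact: unit_finite.
Qed.

Lemma measurable_on_chain n F (f : mass_partition R -> \bar R) :
  measurable_fun [set: state] f -> measurable_fun F (fun w => f (X n w)).
Proof.
by move=> mf; apply: measurable_funTS; exact: (measurableT_comp mf (measurable_chain
  chainX n)).
Qed.

(** As [f] vanishes at the starting state, killing the chain on its return loses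
    nothing, and one step of the chain is one application of the kernel. *)
Lemma excursion_step n (f : mass_partition R -> \bar R) :
  (forall q, (0 <= f q)%E) -> measurable_fun [set: state] f ->
  (forall q, ~ away q -> f q = 0%E) ->
  (\int[P]_(w in excursion n.+1) f (X n.+1 w) = \int[P]_(w in excursion n) K f (X n w))%E.
Proof.
move=> f0 mf fa; rewrite -(chain_step bm01 bs01 chainX (@history_excursion n) f0 mf).
rewrite integral_mkcond [RHS]integral_mkcond; apply: eq_integral => w _.
rewrite !patchE; case: ifPn => [/set_mem [en _]|]; first by rewrite mem_set.
move=> /negP nn; case: ifPn => // /set_mem en; apply/esym/fa => aw.
by apply: nn; apply/mem_set; split.
Qed.

Lemma finite_split_half n p i u : finite_partition n p -> (i < n)%N -> I u ->
  finite_partition n.+1 (split_part i u p).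
Proof.
move=> pn ni /in_half[u0 u1 _]; apply: finite_split => //.
by rewrite u0 (le_lt_trans u1)//; lra.
Qed.

Lemma integral_half_cst (c : R) : (\int[sigma]_(u in I) c%:E = c%:E)%E.
Proof. by rewrite integral_cst// [X in (_ * X)%E](_ : _ = 1%E) ?mule1. Qed.

(** Merging and splitting a state with finitely many parts and unit mass yields
    another one, and the transition probabilities add up to 1. *)
Lemma kernel_proper p : proper_partition p ->
  (1 <= K (fun q => (\1_(proper_partition) q : R)%:E) p)%E.
Proof.
move=> [n pn].
have := @kernel_op_ge R sigma bm bs bm01 bs01 n p
  (fun q => (\1_(proper_partition) q : R)%:E) pn _ 1 1 (fun=> 0) (fun=> 1).
rewrite /drift_bound; set Q := \sum_(i < n) p i ^+ 2.
have -> : \sum_(i < n) p i * (1 - p i) * 0 = 0.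
  by apply: big1 => i _; rewrite mulr0.
have -> : \sum_(i < n) p i ^+ 2 * 1 = Q.
  by apply: eq_bigr => i _; rewrite mulr1.
rewrite (_ : _ + _ = 1); last by ring.
apply => [q|i j ij jn|i ni|]; first by rewrite lee_fin.
- rewrite !addr0 indicE mem_set//; exists n.-1; apply: finite_merge => //.
    exact: ltn_trans jn.
  by rewrite ltn_eqF.
- under eq_integral => u /set_mem uI.
    rewrite indicE mem_set; last by exists n.+1; exact: finite_split_half.
    over.
  by rewrite integral_half_cst.
- by rewrite indicE mem_set//; exists n.
Qed.

Lemma ae_proper n : P (~` (X n @^-1` proper_partition)) = 0%E.
Proof.
have mX m : measurable (X m @^-1` proper_partition).
  rewrite -[X in measurable X]setTI; apply: (measurable_chain chainX) => //.
  exact: measurable_proper.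
suff : P (X n @^-1` proper_partition) = 1%E.
  by move=> p1; rewrite probability_setC// p1 subee.
elim: n => [|n IH].
  have [_ [N [mN N0 hN]] _] := chainX.
  apply/eqP; rewrite eq_le probability_le1//= -(@probability_setT _ _ _ P).
  rewrite -[leRHS]adde0 -N0 -[leLHS]/(P setT).
  apply: le_trans (measureU2 _ _ _) => //.
  apply: le_measure; rewrite ?inE//; first by apply: measurableU.
  move=> w _; have [aw|aw] := pselect (X 0 w = unit); [left|right; exact: hN].
  by rewrite /= aw; exists 1%N; exact: unit_finite.
apply/eqP; rewrite eq_le probability_le1//= -IH.
pose F := X n @^-1` proper_partition.
have hF : history X n F by apply: history_preimage => //; exact: measurable_proper.
pose f q : \bar R := (\1_(proper_partition : set (mass_partition R)) q : R)%:E.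
have f0 q : (0 <= f q)%E by rewrite lee_fin.
have mf : measurable_fun [set: state] f.
  by apply/measurable_EFinP; apply: measurable_indic; exact: measurable_proper.
have := chain_step bm01 bs01 chainX hF f0 mf.
rewrite [X in X = _ -> _](_ : _ = P (X n.+1 @^-1` proper_partition `&` F)); last first.
  by rewrite -integral_indic ?mX// /F; exact: mX.
move=> e; apply: (@le_trans _ _ (P (X n.+1 @^-1` proper_partition `&` F))); last first.
  apply: le_measure; rewrite ?inE//; exact: (measurableI _ _ (mX _) (mX _)).
rewrite e -[leLHS]mul1e -integral_cst//; apply: ge0_le_integral => //.
- by apply: measurable_on_chain; exact: (measurable_kernel_op sigma bm bs f0 mf).
- by move=> w; exact: kernel_proper.
Qed.

Definition no_return n : set T :=
  [set w | forall k, (1 <= k <= n)%N -> X k w <> X 0 w].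

Lemma no_returnS n : no_return n.+1 = no_return n `&` ~` [set w | X n.+1 w = X 0 w].
Proof.
apply/seteqP; split=> [w h|w [h hn] k /andP[k1]].
  split; last by apply: h; rewrite ltnS leqnn.
  by move=> k /andP[k1 kn]; apply: h; rewrite k1 ltnW.
by rewrite leq_eqVlt => /orP[/eqP->//|kn]; apply: h; rewrite k1.
Qed.

Lemma measurable_no_return n : measurable (no_return n).
Proof.
have mc k i : measurable_fun setT (fun w => (X k w i)%:E).
  apply/measurable_EFinP; exact: (measurableT_comp (measurable_part i) (measurable_chain
    chainX k)).
elim: n => [|n IH].
  rewrite (_ : no_return 0 = setT)//; apply/seteqP; split=> // w _ k.
  by move=> /andP[]; case: k.
rewrite no_returnS; apply: measurableI => //; apply: measurableC.
rewrite (_ : [set w | _] = \bigcap_i [set w | (X n.+1 w i)%:E = (X 0 w i)%:E]).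
  apply: bigcapT_measurable => i; rewrite -[X in measurable X]setTI.
  exact: measurable_eqe.
apply/seteqP; split=> [w /= e i _ /=|w h] /=; first by rewrite e.
by apply: mass_partition_inj => i; apply: EFin_inj; exact: h.
Qed.

Lemma excursionP n w : excursion n w <->
  X 0 w = unit /\ forall k, (1 <= k <= n)%N -> away (X k w).
Proof.
elim: n => [|n IH]; first by split=> [-> //|[]//]; split=> // -[].
split=> [[/IH[w0 h] aw]|[w0 h]].
  by split=> // k /andP[k1]; rewrite leq_eqVlt => /orP[/eqP->//|kn]; apply: h; rewrite k1.
split; last by apply: h; rewrite ltnS leqnn.
by apply/IH; split=> // k /andP[k1 kn]; apply: h; rewrite k1 ltnW.
Qed.

(** The two events differ by the null event that the chain starts elsewhere or
    leaves the proper states. *)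
Lemma no_return_excursion n : P (no_return n) = P (excursion n).
Proof.
have mX m : measurable (X m @^-1` proper_partition).
  rewrite -[X in measurable X]setTI; apply: (measurable_chain chainX) => //.
  exact: measurable_proper.
pose bad := ~` (X 0 @^-1` [set unit]) `|` \bigcup_k ~` (X k @^-1` proper_partition).
have mbad : measurable bad.
  apply: measurableU; last by apply: bigcupT_measurable => k; apply: measurableC.
  by apply: measurableC; exact: (@measurable_excursion 0).
have bad0 : P bad = 0%E.
  apply: measure_negligible => //; apply: negligibleU.
    by have [_ [N [mN N0 hN]] _] := chainX; exists N.
  apply: negligible_bigcup => k; apply/negligibleP; first exact: measurableC.
  exact: ae_proper.
apply/eqP; rewrite eq_le; apply/andP; split; last first.
  apply: le_measure; rewrite ?inE; [exact: measurable_excursion|exact: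
    measurable_no_return|].
  move=> w /excursionP[w0 h] k /h[_]; by rewrite w0.
rewrite -[leRHS]adde0 -bad0; apply: le_trans (measureU2 _ _ _) => //.
apply: le_measure; rewrite ?inE; [exact: measurable_no_return| |].
  by apply: measurableU => //; exact: measurable_excursion.
move=> w h; have [bw|bw] := pselect (bad w); [by right|left].
have w0 : X 0 w = unit.
  by apply: contrapT => h0; apply: bw; left.
apply/excursionP; split=> // k k1n; split; last by rewrite /= -w0; exact: h.
by apply: contrapT => h0; apply: bw; right; exists k.
exact: measurable_excursion.
Qed.

Lemma series_one (a : nat -> \bar R) : (forall n, a n = 1%E) ->
  (\sum_(0 <= n <oo) a n = +oo)%E.
Proof.
move=> a1; apply: eq_infty => r.
apply: (@le_trans _ _ (Num.bound `|r|)%:R%:E).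
  by rewrite lee_fin; apply: le_trans (ler_norm r) _; exact/ltW/archi_boundP.
apply: le_trans (nneseries_lim_ge (Num.bound `|r|) _); last by move=> n _ _; rewrite a1.
rewrite (eq_bigr (fun=> 1%E)); last by move=> n _; rewrite a1.
by rewrite sumEFin sumr_const_nat subn0.
Qed.

Lemma return_timeE w :
  return_time R X w = (\sum_(0 <= n <oo) (\1_(no_return n) w : R)%:E)%E.
Proof.
have [ret|nret] := pselect (exists k, `[< (1 <= k)%N /\ X k w = X 0 w >]); last first.
  rewrite series_one => [|n]; last first.
    rewrite indicE mem_set// => k /andP[k1 _] kw; apply: nret.
    by exists k; apply/asboolP.
  rewrite /return_time (_ : [set _ | _ in _] = set0) ?ereal_inf0//.
  apply/seteqP; split=> // x [k hk _]; apply: nret.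
  by exists k; apply/asboolP.
have [m /asboolP[m1 mw] minm] := find_ex_minn ret.
have nr n : (\1_(no_return n) w : R) = (n < m)%N%:R.
  case: ltnP => nm; rewrite indicE.
    rewrite mem_set// => k /andP[k1 kn] kw.
    have mk : (m <= k)%N by apply: minm; apply/asboolP.
    by move: mk; rewrite leqNgt (leq_ltn_trans kn nm).
  by rewrite memNset// => h; apply: (h m) => //; rewrite m1.
under eq_eseriesr do rewrite nr.
rewrite (@nneseries_finite _ _ m); last 2 first.
- by move=> n; rewrite lee_fin.
- by move=> n mn; rewrite ltnNge mn.
rewrite (eq_bigr (fun=> 1%E)); last by move=> i _; rewrite ltn_ord.
rewrite sumEFin sumr_const card_ord; apply/eqP; rewrite eq_le; apply/andP; split.
  by apply: ereal_inf_lbound; exists m.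
apply: le_ereal_inf_tmp => _ [k hk <-]; rewrite lee_fin ler_nat; apply: minm.
exact/asboolP.
Qed.

(** The expectation of the return time is the sum of its tail probabilities. *)
Lemma integral_return_time :
  (\int[P]_w return_time R X w = \sum_(0 <= n <oo) P (excursion n))%E.
Proof.
under eq_integral do rewrite return_timeE.
rewrite integral_nneseries//; last first.
  by move=> n; apply/measurable_EFinP; apply: measurable_indic;
    exact: measurable_no_return.
apply: eq_eseriesr => n _; rewrite integral_indic// ?setIT.
  exact: no_return_excursion.
exact: measurable_no_return.
Qed.

(** The event of a return is the increasing union of the events of a return
    before time [n]. *)
Lemma transient_excursion (c : R) : 0 < c -> (forall n, (c%:E <= P (excursion n))%E) ->
  transient P X.
Proof.
move=> c0 hc; rewrite /transient.
have mN n : measurable (~` no_return n) by apply: measurableC;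
  exact: measurable_no_return.
rewrite (_ : [set w | _] = \bigcup_n ~` no_return n); last first.
  apply/seteqP; split=> [w /=|w [n _ nw] /=].
    rewrite return_timeE => rt; apply: contrapT => h.
    move: rt; rewrite series_one// => n; rewrite indicE mem_set//.
    by apply: contrapT => nw; apply: h; exists n.
  have [k [k1 kw]] : exists k, (1 <= k)%N /\ X k w = X 0 w.
    apply: contrapT => h; apply: nw => k /andP[k1 _] kw; apply: h.
    by exists k.
  apply: (@le_lt_trans _ _ k%:R%:E); last exact: ltry.
  by apply: ereal_inf_lbound; exists k.
apply: (@le_lt_trans _ _ (1 - c)%:E); last by rewrite lte_fin; lra.
have nd : {homo (fun n => ~` no_return n) : n m / (n <= m)%N >-> (n <= m)%O}.
  move=> n m nm; apply/subsetPset/subsetC => w h k /andP[k1 kn].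
  by apply: h; rewrite k1 (leq_trans kn).
have cv := @nondecreasing_cvg_mu _ _ _ P _ mN (bigcupT_measurable _ mN) nd.
rewrite -(cvg_lim _ cv)//; apply: lime_le; first by apply/cvg_ex; eexists; exact: cv.
apply: nearW => n /=; rewrite probability_setC; last exact: measurable_no_return.
rewrite EFinB; apply: leeB => //; rewrite -[leRHS]/(P (no_return n)) no_return_excursion.
exact: hc.
Qed.

End excursions.

(** * The smallest part and lower bounds on survival *)

Section min_part.
Context (R : realType).
Implicit Types (p q : mass_partition R) (x u : R).
Local Notation state := (g_sigma_algebraType (@coord_sets R)).

(** The value 1 is added so that the infimum is over a nonempty set; it changes
    nothing for states of mass 1, whose parts are at most 1. *)
Definition min_part p : R := inf [set x | x = 1 \/ exists2 i, 0 < p i & p i = x].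

Let lbound0 p : lbound [set x | x = 1 \/ exists2 i, 0 < p i & p i = x] 0.
Proof. by move=> x [->|[i pi <-]]//; exact: ltW. Qed.

Let nonempty p : [set x | x = 1 \/ exists2 i, 0 < p i & p i = x] !=set0.
Proof. by exists 1; left. Qed.

Lemma min_part_ge0 p : 0 <= min_part p.
Proof. by apply: lb_le_inf => //; exact: lbound0. Qed.

Lemma min_part_le1 p : min_part p <= 1.
Proof. by apply: ge_inf; [exists 0; exact: lbound0|left]. Qed.

Lemma min_part_le p i x : 0 < p i -> p i <= x -> min_part p <= x.
Proof.
move=> pi; apply: le_trans; apply: ge_inf; first by exists 0; exact: lbound0.
by right; exists i.
Qed.

Lemma min_part_attained n p : finite_partition n p ->
  exists2 i, (i < n)%N & p i = min_part p.
Proof.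
move=> pn; have n0 := finite_partition_gt0 pn.
exists n.-1; first by rewrite prednK.
have pi : 0 < p n.-1 by rewrite pn.1 prednK.
apply/eqP; rewrite eq_le (min_part_le pi)// andbT.
apply: lb_le_inf => // x [->|[i + <-]]; first exact: finite_partition_le1 pn.
by rewrite pn.1 => ni; apply: part_noninc; rewrite -ltnS prednK.
Qed.

Lemma min_part_lt p x : (min_part p < x) <-> 1 < x \/ exists i, 0 < p i < x.
Proof.
split=> [/(inf_lt (nonempty p))[y [->|[i pi <-]] yx]|[x1|[i /andP[pi ix]]]].
- by left.
- by right; exists i; rewrite pi.
- exact: le_lt_trans (min_part_le1 p) x1.
- exact: le_lt_trans (min_part_le pi (lexx _)) ix.
Qed.

Lemma measurable_min_part : measurable_fun [set: state] min_part.
Proof.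
apply: (measurability _ (RGenInftyO.measurableE R)) => // _ [_ [x ->] <-].
rewrite setTI; have [x1|x1] := ltP 1 x.
  rewrite [X in measurable X](_ : _ = setT)//; apply/seteqP; split=> // p _ /=.
  by rewrite in_itv/=; apply/min_part_lt; left.
have mI i : measurable ((fun p : mass_partition R => p i) @^-1` `]0, x[ : set state).
  by rewrite -[X in measurable X]setTI; apply: measurable_part.
rewrite [X in measurable X](_ : _ = \bigcup_i ((fun p : mass_partition R => p i) @^-1`
  `]0, x[)).
  exact: bigcupT_measurable.
apply/seteqP; split=> p /=; rewrite in_itv/=.
  by move=> /min_part_lt[|[i pi]]; [rewrite ltNge x1|exists i; rewrite //= in_itv].
by move=> [i _ /=]; rewrite in_itv/= => pi; apply/min_part_lt; right; exists i.
Qed.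

(** The part [k] is still there after the merge. *)
Lemma min_part_merge i j k p : i != j -> k != i -> k != j -> 0 < p k ->
  min_part (merge_parts i j p) <= p k.
Proof.
move=> ij /negbTE ki /negbTE kj pk.
have e : merge_seq i j p k = p k by rewrite /merge_seq ki kj.
have [|l el] := @same_parts_ex R _ _ k (merge_same_parts p ij); first by rewrite e.
by apply: (@min_part_le _ l); rewrite el e.
Qed.

Lemma min_part_split i k u p : 0 < u < 1 -> 0 < p i -> 0 < p k ->
  min_part (split_part i u p) <= p k /\ min_part (split_part i u p) <= u * p i.
Proof.
move=> /andP[u0 u1] pi pk; have u01 : 0 <= u <= 1 by rewrite !ltW.
have s := split_same_parts i p u01.
have ui : min_part (split_part i u p) <= u * p i.
  have e : split_seq i u p i.+1 = u * p i by rewrite /= eqxx.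
  have [|l el] := @same_parts_ex R _ _ i.+1 s; first by rewrite e mulr_gt0.
  by apply: (@min_part_le _ l); rewrite el e ?mulr_gt0.
split=> //; have [->|/negbTE ki] := eqVneq k i.
  by apply: le_trans ui _; rewrite ger_pMl// ltW.
have e : split_seq i u p k.+1 = p k by rewrite /= ki.
have [|l el] := @same_parts_ex R _ _ k.+1 s; first by rewrite e.
by apply: (@min_part_le _ l); rewrite el e.
Qed.

End min_part.

(** Three distinct indices below [n]. *)
Lemma third_index (i j k n : nat) : (i < j)%N -> (j < n)%N -> (k < n)%N ->
  i != k -> j != k -> (2 < n)%N.
Proof. by move=> ij jn kn /eqP ik /eqP jk; lia. Qed.

Section subharmonic.
Context (R : realType) (sigma : probability R R) (bm bs : R).
Hypotheses (bm01 : 0 < bm <= 1) (bs01 : 0 < bs <= 1).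
Hypothesis sigma1 : sigma (`]0, 2^-1]%classic : set R) = 1%E.
Local Notation state := (g_sigma_algebraType (@coord_sets R)).
Local Notation K := (kernel_op sigma bm bs).
Local Notation I := (`]0, 2^-1%R]%classic : set R).
Local Notation unit := (@unit_partition R).
Implicit Types (p q : mass_partition R).

Lemma finite_partition_uniq n n' p :
  finite_partition n p -> finite_partition n' p -> n = n'.
Proof.
move=> /finite_part_count pn /finite_part_count; rewrite pn => -[] /eqP.
by rewrite eqr_nat => /eqP.
Qed.

Lemma finite_away n p : finite_partition n p -> (1 < n)%N -> away p.
Proof.
move=> pn n1; split; first by exists n.
move=> /= pu; move: pn; rewrite pu => /(finite_partition_uniq (unit_finite R)) n1E.
by rewrite -n1E in n1.
Qed.

Lemma awayP p : away p -> exists2 n, (1 < n)%N & finite_partition n p.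
Proof.
move=> [[n pn] pu]; exists n => //; case: n pn => [|[|n]]// pn.
  by have := finite_partition_gt0 pn.
by exfalso; exact/pu/finite_partition1.
Qed.

(** The constant [k] allows a lower bound that is negative for some [u] although
    the integrals are taken of nonnegative functions. *)
Lemma integral_split_ge (f : mass_partition R -> \bar R) i p (c e k y : R) :
  (forall q, (0 <= f q)%E) -> measurable_fun [set: state] f ->
  0 <= c -> 0 <= e -> 0 <= k -> y <= 2^-1 ->
  (forall u, I u ->
    ((c + e * \1_(`]0%R, y]%classic : set R) u)%:E <= f (split_part i u p) + k%:E)%E) ->
  ((c - k + e * fine (sigma (`]0%R, y]%classic : set R)))%:E
     <= \int[sigma]_(u in I) f (split_part i u p))%E.
Proof.
move=> f0 mf c0 e0 k0 y2 h.
have mI : measurable (`]0%R, y]%classic : set R) by exact: measurable_itv.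
have e1 u : (0 <= (e * \1_(`]0%R, y]%classic : set R) u)%:E)%E by rewrite lee_fin
  mulr_ge0.
have : (\int[sigma]_(u in I) (c + e * \1_(`]0%R, y]%classic : set R) u)%:E <=
    \int[sigma]_(u in I) (f (split_part i (clamp u) p) + k%:E))%E.
  apply: ge0_le_integral => //.
  - by move=> u _; rewrite EFinD adde_ge0.
  - by apply/measurable_EFinP; apply: measurable_funTS; apply: measurable_funD => //;
    apply: measurable_funM => //; exact: measurable_indic.
  - apply: emeasurable_funD => //.
    by apply: measurable_funTS; exact: measurable_split_u.
  - move=> u uI; have [_ _ u01] := in_half uI.
    by rewrite clamp_id//; exact: h.
under eq_integral do rewrite EFinD.
rewrite ge0_integralD//; last first.
  by apply/measurable_EFinP; apply: measurable_funTS; apply: measurable_funM => //;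
    exact: measurable_indic.
rewrite ge0_integralD//; last first.
  by apply: measurable_funTS; exact: measurable_split_u.
rewrite !integral_half_cst// -integral_split_clamp.
under eq_integral do rewrite EFinM.
rewrite ge0_integralZl_EFin//; last by apply/measurable_EFinP; apply: measurable_funTS;
  exact: measurable_indic.
rewrite integral_indic// (_ : `]0%R, y]%classic `&` I = `]0%R, y]%classic); last first.
  apply/seteqP; split=> [u []//|u uy]; split => //; move: uy; rewrite /= !in_itv/=.
  by move=> /andP[-> /le_trans ->].
have fs : sigma `]0%R, y]%classic \is a fin_num by exact: fin_num_measure.
set s := fine _; move=> H.
have -> : c - k + e * s = (c + e * s) - k by ring.
by rewrite EFinB leeBlDr// EFinD EFinM /s fineK.
Qed.

Lemma kernel_unit_ge (f : mass_partition R -> \bar R) : (forall q, (0 <= f q)%E) ->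
  (bs%:E * \int[sigma]_(u in I) f (split_part 0 u unit) <= K f unit)%E.
Proof.
move=> f0; rewrite (kernel_op_finite sigma bm bs (unit_finite R) f0).
rewrite -(finite_hold_rate bm bs (unit_finite R)).
rewrite !big_ord1 big_mkcond big_ord1 ltnn mule0 add0e expr1n mul1e.
by rewrite leeDl// mule_ge0// lee_fin hold_rate_ge0.
Qed.

Lemma sum_single n i0 (F : nat -> R) (c : R) : (i0 < n)%N ->
  \sum_(i < n) F i * (if (i : nat) == i0 then c else 0) = F i0 * c.
Proof.
move=> ni; rewrite (bigD1 (Ordinal ni))//= eqxx big1 ?addr0// => i ii.
by rewrite ifN ?mulr0//; apply: contra ii => /eqP ii; apply/eqP/val_inj.
Qed.

Context (d : measure_display) (T : measurableType d) (P : probability T R)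
    (X : nat -> T -> mass_partition R).
Hypothesis chainX : markov_chain (split_merge_kernel sigma bm bs) unit_partition P X.

Lemma excursion0 : P (excursion X 0) = 1%E.
Proof.
rewrite -(no_return_excursion bm01 bs01 sigma1 chainX).
rewrite (_ : no_return X 0 = setT) ?probability_setT//.
by apply/seteqP; split=> // w _ k /andP[]; case: k.
Qed.

Lemma excursion1_integral (f : mass_partition R -> \bar R) : (forall q, (0 <= f q)%E) ->
  measurable_fun [set: state] f -> (forall q, ~ away q -> f q = 0%E) ->
  (\int[P]_(w in excursion X 1) f (X 1%N w) = K f unit)%E.
Proof.
move=> f0 mf fa; rewrite (excursion_step bm01 bs01 chainX)//.
rewrite (eq_integral (fun=> K f unit)); last by move=> w /set_mem /= ->.
rewrite integral_cst; last exact: (@measurable_excursion _ _ _ _ _ _ _ _ chainX 0).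
by rewrite [X in (_ * X)%E]excursion0 mule1.
Qed.

(** The expectation of [g k] at time [m + 1] on survival dominates that of
    [g k.+1] at time [m].  The index [k] counts the remaining steps. *)
Lemma excursion_subharmonic (g : nat -> mass_partition R -> \bar R) :
  (forall k q, (0 <= g k q)%E) -> (forall k q, (g k q <= 1)%E) ->
  (forall k, measurable_fun [set: state] (g k)) ->
  (forall k q, ~ away q -> g k q = 0%E) ->
  (forall k p, away p -> (g k.+1 p <= K (g k) p)%E) ->
  forall n, (K (g n) unit <= P (excursion X n.+1))%E.
Proof.
move=> g0 g1 mg ga gK n.
have mE m := @measurable_excursion R sigma bm bs d T P X chainX m.
have step m k : (\int[P]_(w in excursion X m.+1) g k.+1 (X m.+1 w) <=
    \int[P]_(w in excursion X m.+2) g k (X m.+2 w))%E.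
  rewrite [leRHS](excursion_step bm01 bs01 chainX _ (g0 k) (mg k) (ga k)).
  apply: ge0_le_integral => //.
  - by apply: (measurable_on_chain chainX).
  - apply: (measurable_on_chain chainX).
    exact: (measurable_kernel_op sigma bm bs (g0 k) (mg k)).
  - by move=> w [_ aw]; exact: gK.
have survive : forall m k, (\int[P]_(w in excursion X 1) g (m + k)%N (X 1%N w) <=
    \int[P]_(w in excursion X m.+1) g k (X m.+1 w))%E.
  elim=> [|m IH] k; first by rewrite add0n.
  by rewrite addSnnS; apply: le_trans (IH _) _; exact: step.
rewrite -(excursion1_integral (g0 n) (mg n) (ga n)).
have := survive n 0%N; rewrite addn0 => /le_trans; apply.
rewrite -[leRHS]mul1e -integral_cst//; apply: ge0_le_integral => //.
by apply: (measurable_on_chain chainX).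
Qed.

End subharmonic.

(** * Positive recurrence forces a finite inverse moment *)

Section monotone.
Context (R : realType).

(** Both [1 / u] and [1 / sigma (0, u]] decrease on the interval of interest. *)
Lemma nonincreasing_emeasurable (D : set R) (f : R -> \bar R) : is_interval D ->
  (forall x y, D x -> D y -> x <= y -> (f y <= f x)%E) -> measurable_fun D f.
Proof.
move=> iD fD; apply: (measurability _ (ErealGenOInfty.measurableE R)) => // _ [_ [y ->]
  <-].
apply: is_interval_measurable => s t /= [Ds fs] [Dt ft] u /andP[su ut].
have Du : D u by apply: (iD s t) => //; rewrite su.
split=> //; move: ft; rewrite !in_itv/= !andbT => /lt_le_trans; apply.
exact: fD.
Qed.

Lemma measurable_inv_half : measurable_fun (`]0, 2^-1]%classic : set R)
  (fun u : R => (u^-1)%:E).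
Proof.
apply: nonincreasing_emeasurable => [|x y]; first exact: interval_is_interval.
rewrite /= !in_itv/= => /andP[x0 _] /andP[y0 _] xy.
by rewrite lee_fin lef_pV2.
Qed.

End monotone.

Section necessity.
Context (R : realType) (sigma : probability R R) (bm bs : R).
Hypotheses (bm01 : 0 < bm <= 1) (bs01 : 0 < bs <= 1).
Hypothesis sigma1 : sigma (`]0, 2^-1]%classic : set R) = 1%E.
Local Notation state := (g_sigma_algebraType (@coord_sets R)).
Local Notation K := (kernel_op sigma bm bs).
Local Notation I := (`]0, 2^-1%R]%classic : set R).
Local Notation unit := (@unit_partition R).
Implicit Types (p q : mass_partition R).

Lemma sqnorm_finite_bounds n p : finite_partition n p ->
  0 <= \sum_(i < n) p i ^+ 2 <= 1.
Proof.
move=> pn; rewrite sumr_ge0/=; last by move=> i _; rewrite exprn_ge0// part_ge0.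
rewrite -[leRHS]pn.2; apply: ler_sum => i _.
by rewrite expr2 ler_piMl ?part_ge0// (finite_partition_le1 _ pn).
Qed.

(** A lower bound for the probability that the smallest part of [p] survives [k]
    steps. *)
Definition unmerged_weight (k : nat) p : \bar R :=
  (\1_(@away R) p * ((1 - min_part p) ^+ 2) ^+ k)%:E.

Lemma unmerged_weight_ge0 k p : (0 <= unmerged_weight k p)%E.
Proof. by rewrite lee_fin mulr_ge0// exprn_ge0// exprn_even_ge0. Qed.

Lemma unmerged_weight_le1 k p : (unmerged_weight k p <= 1)%E.
Proof.
rewrite lee_fin mulr_ile1 ?exprn_ge0 ?exprn_even_ge0//.
  by rewrite subr_ge0 min_part_le1.
have m0 := min_part_ge0 p; have m1 := min_part_le1 p.
by rewrite exprn_ile1 ?exprn_even_ge0// exprn_ile1//; lra.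
Qed.

Lemma measurable_unmerged_weight k : measurable_fun [set: state] (unmerged_weight k).
Proof.
apply/measurable_EFinP; apply: measurable_funM.
  by apply: measurable_indic; exact: measurable_away.
apply: measurable_funX; apply: measurable_funX; apply: measurable_funB => //.
exact: measurable_min_part.
Qed.

Lemma unmerged_weight_away k p : ~ away p -> unmerged_weight k p = 0%E.
Proof. by move=> np; rewrite /unmerged_weight indicE memNset// mul0r. Qed.

Lemma unmerged_weight_mono k p (m : R) : away p -> min_part p <= m -> m <= 1 ->
  ((((1 - m) ^+ 2) ^+ k)%:E <= unmerged_weight k p)%E.
Proof.
move=> ap pm m1; rewrite /unmerged_weight lee_fin indicE mem_set// mul1r.
have m0 := min_part_ge0 p.
apply: lerXn2r; rewrite ?nnegrE ?exprn_even_ge0//.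
by apply: lerXn2r; rewrite ?nnegrE; lra.
Qed.

(** The smallest part is merged with probability [2 bm m (1 - m)], and
    [(1 - m)^2 <= 1 - 2 m (1 - m)]; any other move can only lower the smallest
    part and increase the weight. *)
Lemma unmerged_weight_step k p : away p ->
  (unmerged_weight k.+1 p <= K (unmerged_weight k) p)%E.
Proof.
move=> ap; have [n n1 pn] := awayP ap.
have [i0 i0n pi0] := min_part_attained pn.
set m := min_part p in pi0.
have p0 : 0 < p i0 by rewrite pn.1.
have m01 : 0 <= m <= 1 by rewrite min_part_ge0 min_part_le1.
have /andP[m0 m1] := m01.
set A := ((1 - m) ^+ 2) ^+ k.
have A0 : 0 <= A by rewrite exprn_ge0// exprn_even_ge0.
have := @kernel_op_ge R sigma bm bs bm01 bs01 n p (unmerged_weight k) pn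
  (unmerged_weight_ge0 k) A A (fun i => if i == i0 then - A else 0) (fun=> A).
rewrite /drift_bound (sum_single (fun i => p i * (1 - p i)) _ i0n).
have := sqnorm_finite_bounds pn.
set Q := \sum_(i < n) p i ^+ 2 => /andP[Q0 Q1].
rewrite -mulr_suml -/Q => H; apply: le_trans (H _ _ _).
- rewrite /unmerged_weight lee_fin indicE mem_set// mul1r exprS -/m -/A pi0.
  case/andP: bm01 => b0 b1; case/andP: bs01 => s0 s1.
  rewrite [leRHS](_ : _ = (1 - 2 * bm * (m * (1 - m))) * A); last by ring.
  apply: ler_wpM2r => //.
  have mm : 0 <= m * (1 - m) by rewrite mulr_ge0// subr_ge0.
  have bmm : bm * (m * (1 - m)) <= m * (1 - m) by rewrite ler_piMl.
  by rewrite expr2; nra.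
- move=> i j ij jn.
  have [ei|ei] := eqVneq i i0.
    rewrite ei subrr add0r; apply: le_trans (unmerged_weight_ge0 _ _).
    by rewrite lee_fin; case: eqP => _; rewrite ?oppr_le0.
  have [ej|ej] := eqVneq j i0.
    by rewrite addr0 subrr; exact: unmerged_weight_ge0.
  rewrite !addr0; apply: unmerged_weight_mono => //; last first.
    by rewrite -pi0; apply: min_part_merge => //;
      [rewrite ltn_eqF|rewrite eq_sym|rewrite eq_sym].
  have fm : finite_partition n.-1 (merge_parts i j p).
    by apply: finite_merge => //; [exact: ltn_trans jn|rewrite ltn_eqF].
  apply: finite_away fm _; have := third_index ij jn i0n ei ej.
  by case: (n) => [|[|[]]].
- move=> i ni.
  have := @integral_split_ge R sigma sigma1 (unmerged_weight k) i p A 0 0 0.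
  rewrite subr0 mul0r addr0; apply => //.
  + exact: unmerged_weight_ge0.
  + exact: measurable_unmerged_weight.
  + move=> u uI; rewrite mul0r addr0 adde0.
    have [u0 u1 u01] := in_half uI.
    have pi : 0 < p i by rewrite pn.1.
    apply: unmerged_weight_mono => //.
      by apply: finite_away (finite_split_half pn ni uI) _; exact: ltnW.
    rewrite -pi0; apply: (min_part_split _ pi p0).1.
    by rewrite u0 (le_lt_trans u1)//; lra.
- by apply: unmerged_weight_mono.
Qed.

(** The sum is [1 / (1 - (1 - u)^2)], and [1 - (1 - u)^2 <= 2 u]. *)
Lemma geometric_half (u : R) : 0 < u <= 1 ->
  ((2 * u)^-1%:E <= \sum_(0 <= n <oo) (((1 - u) ^+ 2) ^+ n)%:E)%E.
Proof.
move=> /andP[u0 u1]; set v := (1 - u) ^+ 2.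
have v0 : 0 <= v by rewrite exprn_even_ge0.
have a0 n : (0 <= (v ^+ n)%:E)%E by rewrite lee_fin exprn_ge0.
set S := (\sum_(0 <= n <oo) _)%E.
have S0 : (0 <= S)%E by apply: nneseries_ge0.
(* this determines S when it is finite *)
have SE : S = (1 + v%:E * S)%E.
  rewrite [LHS]nneseries_recl// expr0; congr (_ + _)%E.
  rewrite -(nneseries_addn 1)// -nneseriesZl//; apply: eq_eseriesr => n _.
  by rewrite addn1 exprS EFinM.
move: SE S0; case: S => [s| |]//; last by move=> *; rewrite leey.
rewrite -EFinM -EFinD lee_fin => -[] se s0.
rewrite lee_fin -div1r ler_pdivrMr; last by rewrite mulr_gt0.
have sv : s * (1 - v) = 1 by rewrite mulrBr mulr1 {1}se [s * v]mulrC; ring.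
rewrite -[leLHS]sv; apply: ler_wpM2l => //.
by rewrite /v expr2; have := sqr_ge0 u; rewrite expr2; lra.
Qed.

Context (d : measure_display) (T : measurableType d) (P : probability T R)
    (X : nat -> T -> mass_partition R).
Hypothesis chainX : markov_chain (split_merge_kernel sigma bm bs) unit_partition P X.

Lemma positive_recurrent_integral : positive_recurrent P X ->
  (\int[sigma]_(x in I) (x^-1)%:E < +oo)%E.
Proof.
rewrite /positive_recurrent (integral_return_time bm01 bs01 sigma1 chainX) => H.
have mp n : measurable_fun I (fun u : R => (((1 - u) ^+ 2) ^+ n)%:E).
  apply/measurable_EFinP; apply: measurable_funTS.
  by apply: measurable_funX; apply: measurable_funX; exact: measurable_funB.
have inv2 (u : R) : (((2 * u)^-1)%:E = (2^-1)%:E * (u^-1)%:E)%E.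
  by rewrite -EFinM invfM.
have bound n : (bs%:E * \int[sigma]_(u in I) (((1 - u) ^+ 2) ^+ n)%:E <=
    P (excursion X n.+1))%E.
  apply: le_trans (excursion_subharmonic bm01 bs01 sigma1 chainX
    unmerged_weight_ge0 unmerged_weight_le1 measurable_unmerged_weight
    unmerged_weight_away unmerged_weight_step n).
  apply: le_trans (kernel_unit_ge sigma bm01 bs01 (unmerged_weight_ge0 n)).
  apply: lee_wpmul2l; first by rewrite lee_fin; case/andP: bs01 => /ltW.
  rewrite integral_split_clamp; apply: ge0_le_integral => //.
  - by move=> u _; rewrite lee_fin exprn_ge0// exprn_even_ge0.
  - by apply: measurable_funTS; apply: measurable_split_u;
    exact: measurable_unmerged_weight.
  - move=> u uI; have [u0 u1 u01] := in_half uI; rewrite clamp_id//.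
    have u1' : 0 < u < 1 by rewrite u0 (le_lt_trans u1)//; lra.
    apply: unmerged_weight_mono; last by case/andP: u01.
      exact: finite_away (finite_split_half (unit_finite R) (ltnSn 0) uI) _.
    have e1 : unit 0%N = 1 by [].
    have p0 : 0 < unit 0%N by rewrite e1.
    by have [_] := min_part_split u1' p0 p0; rewrite e1 mulr1.
have tot : (bs%:E * \int[sigma]_(u in I) ((2 * u)^-1)%:E <=
    \sum_(0 <= n <oo) P (excursion X n))%E.
  apply: (@le_trans _ _ (\sum_(0 <= n <oo) P (excursion X n.+1))%E); last first.
    rewrite [leRHS]nneseries_recl// -(nneseries_addn 1)//.
    under [in leRHS]eq_eseriesr do rewrite addn1.
    by rewrite leeDr.
  apply: le_trans (lee_nneseries _ (fun n _ => bound n)); last first.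
    move=> n _ _; rewrite mule_ge0//.
      by rewrite lee_fin; case/andP: bs01 => /ltW.
    by apply: integral_ge0 => u _; rewrite lee_fin exprn_ge0// exprn_even_ge0.
  rewrite nneseriesZl; last first.
    by move=> n _; apply: integral_ge0 => u _; rewrite lee_fin exprn_ge0// exprn_even_ge0.
  apply: lee_wpmul2l; first by rewrite lee_fin; case/andP: bs01 => /ltW.
  rewrite -integral_nneseries//; last first.
    by move=> n u _; rewrite lee_fin exprn_ge0// exprn_even_ge0.
  apply: ge0_le_integral => //.
  - by move=> u /in_half[u0 _ _]; rewrite lee_fin invr_ge0 mulr_ge0// ltW.
  - rewrite (_ : (fun u : R => _) = (fun u : R => (2^-1)%:E * (u^-1)%:E)%E).
      by apply: emeasurable_funM => //; exact: measurable_inv_half.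
    by apply/funext => u; rewrite inv2.
  - apply: (@ge0_emeasurable_sum _ _ R I (fun n u => (((1 - u) ^+ 2) ^+ n)%:E) xpredT) =>
    // n u _ _.
    by rewrite lee_fin exprn_ge0// exprn_even_ge0.
  - by move=> u /in_half[u0 _ /andP[_ u1]]; apply: geometric_half; rewrite u0.
have J0 : (0 <= \int[sigma]_(x in I) (x^-1)%:E)%E.
  by apply: integral_ge0 => u /in_half[u0 _ _]; rewrite lee_fin invr_ge0 ltW.
move: tot; under eq_integral do rewrite inv2.
rewrite ge0_integralZl_EFin ?invr_ge0//; last 2 first.
- by move=> u /in_half[u0 _ _]; rewrite lee_fin invr_ge0 ltW.
- exact: measurable_inv_half.
move: J0; case: (\int[sigma]_(x in I) (x^-1)%:E)%E => [r| |]//; first by rewrite ltry.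
rewrite gt0_muley ?lte_fin ?invr_gt0// gt0_muley ?lte_fin; last by case/andP: bs01.
by move=> _ /le_lt_trans /(_ H).
Qed.

End necessity.

(** * Transience *)

Section tail_integral.

(** The complements of the sets [A n] increase to [D], so by monotone convergence
    they eventually carry all but [e] of the integral. *)
Lemma integral_small_sets d (U : measurableType d) (R : realType)
    (mu : {measure set U -> \bar R}) (D : set U) (A : nat -> set U)
    (f : U -> \bar R) (e : R) :
  measurable D -> (forall n, measurable (A n)) -> (forall n, A n `<=` D) ->
  (forall n, A n.+1 `<=` A n) -> \bigcap_n A n = set0 ->
  (forall x, (0 <= f x)%E) -> measurable_fun D f ->
  (\int[mu]_(x in D) f x < +oo)%E -> 0 < e ->
  exists n, (\int[mu]_(x in A n) f x < e%:E)%E.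
Proof.
move=> mD mA AD Adec A0 f0 mf foo e0.
pose F n := D `\` A n.
have mF n : measurable (F n) by exact: measurableD.
have FU : \bigcup_n F n = D.
  apply/seteqP; split=> [x [n _ []]//|x Dx]; apply: contrapT => nF.
  suff : (\bigcap_n A n) x by rewrite A0.
  by move=> n _; apply: contrapT => nA; apply: nF; exists n.
have FS n : F n `<=` D by move=> x [].
have cv : (\int[mu]_(x in F n) f x @[n --> \oo] --> \int[mu]_(x in D) f x)%E.
  rewrite -FU; apply: ge0_nondecreasing_set_cvg_integral => //.
    by apply/nondecreasing_seqP => n; apply/subsetPset; exact: setDS.
  by move=> n; exact: measurable_funS (FS n) mf.
have J0 : (0 <= \int[mu]_(x in D) f x)%E by apply: integral_ge0.
set J := (\int[mu]_(x in D) f x)%E in foo cv J0.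
have Jf : J \is a fin_num by rewrite ge0_fin_numE.
have [n Jn] : exists n, (J - e%:E < \int[mu]_(x in F n) f x)%E.
  apply: contrapT => /forallNP h.
  have : (J <= J - e%:E)%E.
    rewrite -{1}(cvg_lim _ cv)//; apply: lime_le; first by apply/cvg_ex; exists J.
    by apply: nearW => n; rewrite leNgt; apply/negP/h.
  by rewrite leeBrDr// -[leRHS]adde0 leeD2lE// lee_fin leNgt e0.
exists n.
have U' : D = A n `|` F n by rewrite /F setDUK.
have JE : (J = \int[mu]_(x in A n) f x + \int[mu]_(x in F n) f x)%E.
  have mU : measurable_fun (A n `|` F n) f by rewrite -U'.
  rewrite /J [in LHS]U' ge0_integral_setU//.
  by apply/disj_setPS => x [Ax [_]].
have a0 : (0 <= \int[mu]_(x in A n) f x)%E by exact: integral_ge0.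
have b0 : (0 <= \int[mu]_(x in F n) f x)%E by exact: integral_ge0.
move: Jn Jf a0 b0; rewrite JE.
case: (\int[mu]_(x in F n) f x)%E => [s| |]//;
  case: (\int[mu]_(x in _) f x)%E => [t| |]//.
by move=> h _ _ _; have : ((t + s - e)%:E < s%:E)%E := h; rewrite !lte_fin; lra.
Qed.

Context (R : realType).

Definition near0 (n : nat) : set R := `]0, n.+2%:R^-1]%classic.

Lemma near0_half n : 0 < (n.+2%:R^-1 : R) <= 2^-1.
Proof. by rewrite invr_gt0 ltr0n/= lef_pV2 ?posrE// ler_nat. Qed.

Lemma near0_sub n : near0 n `<=` `]0, 2^-1]%classic.
Proof. by apply/subset_itvl; rewrite bnd_simp; case/andP: (near0_half n). Qed.

Lemma near0_dec n : near0 n.+1 `<=` near0 n.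
Proof. by apply/subset_itvl; rewrite bnd_simp lef_pV2 ?posrE// ler_nat. Qed.

Lemma bigcap_near0 : \bigcap_n near0 n = set0.
Proof.
apply/seteqP; split=> // u h.
have u0 : 0 < u by have := h 0%N Logic.I; rewrite /near0/= in_itv/= => /andP[].
have := h (Num.bound u^-1) Logic.I; rewrite /near0/= in_itv/= u0/= leNgt => /negP; apply.
rewrite invf_plt ?posrE//; apply: lt_trans (archi_boundP _) _.
  by rewrite invr_ge0 ltW.
by rewrite ltr_nat ltnS leqnSn.
Qed.

End tail_integral.

Section transience.
Context (R : realType) (sigma : probability R R) (bm bs : R).
Hypotheses (bm01 : 0 < bm <= 1) (bs01 : 0 < bs <= 1).
Hypothesis sigma1 : sigma (`]0, 2^-1]%classic : set R) = 1%E.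
Hypothesis sigma_inv : (\int[lebesgue_measure]_(x in `]0%R, 2^-1%R])
   (sigma `]0%R, x]%classic)^-1 < +oo)%E.
Local Notation state := (g_sigma_algebraType (@coord_sets R)).
Local Notation K := (kernel_op sigma bm bs).
Local Notation I := (`]0, 2^-1%R]%classic : set R).
Local Notation unit := (@unit_partition R).
Implicit Types (p q : mass_partition R).

Let f (y : R) : \bar R := ((sigma `]0%R, y]%classic)^-1)%E.

Let f_ge0 y : (0 <= f y)%E.
Proof. by rewrite /f inve_ge0 measure_ge0. Qed.

Let f_anti x y : x <= y -> (f y <= f x)%E.
Proof.
move=> xy; rewrite /f lee_pV2 ?inE ?measure_ge0//.
apply: le_measure; rewrite ?inE; [exact: measurable_itv|exact: measurable_itv|].
by apply/subset_itvl; rewrite bnd_simp.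
Qed.

Let mf (i : interval R) : measurable_fun [set` i] f.
Proof.
apply: nonincreasing_emeasurable => [|x y _ _]; first exact: interval_is_interval.
exact: f_anti.
Qed.

(** The truncation at 1/2 keeps the integral finite, hence the function monotone,
    on the whole line. *)
Definition split_scale (y : R) : R :=
  fine (\int[lebesgue_measure]_(x in `]0%R, (Num.min y 2^-1)%R]) f x)%E.

Lemma split_scale_integral_fin y :
  (\int[lebesgue_measure]_(x in `]0%R, (Num.min y 2^-1)%R]) f x)%E \is a fin_num.
Proof.
rewrite ge0_fin_numE; last exact: integral_ge0.
apply: le_lt_trans sigma_inv; apply: ge0_subset_integral => //.
  exact: mf.
by apply/subset_itvl; rewrite bnd_simp ge_min lexx orbT.
Qed.

Lemma split_scale_mono x y : x <= y -> split_scale x <= split_scale y.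
Proof.
move=> xy; apply: fine_le; try exact: split_scale_integral_fin.
apply: ge0_subset_integral => //.
  exact: mf.
by apply/subset_itvl; rewrite bnd_simp le_min !ge_min xy lexx !orbT.
Qed.

Lemma split_scale_ge0 y : 0 <= split_scale y.
Proof. by apply: fine_ge0; exact: integral_ge0. Qed.

(** On the upper half of (0, y] the integrand is at least [1 / sigma (0, y]].  If
    the latter were infinite then the integral would be infinite too, which is
    why [sigma] charges every neighbourhood of 0. *)
Lemma split_scale_step y : 0 < y <= 2^-1 ->
  0 < fine (sigma `]0%R, y]%classic) /\
  y / 2 <= fine (sigma `]0%R, y]%classic) * (split_scale y - split_scale (y / 2)).
Proof.
move=> /andP[y0 y2].
have yy : y / 2 < y by lra.
have U : `]0%R, y]%classic = `]0%R, y / 2]%classic `|` `]y / 2, y]%classic :> set R.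
  by apply: itv_bndbnd_setU; rewrite bnd_simp; lra.
have fy : ((y / 2)%:E * f y <= \int[lebesgue_measure]_(x in `](y / 2)%R, y]) f x)%E.
  have := @integral_cst _ _ _ (@lebesgue_measure R) `](y / 2)%R, y]%classic
    (measurable_itv _) (f y).
  rewrite /= lebesgue_measure_itv/= lte_fin yy -EFinB (_ : y - y / 2 = y / 2);
    last by field.
  rewrite muleC => <-; apply: ge0_le_integral => //.
    exact: mf.
  by move=> x; rewrite /= in_itv/= => /andP[_ xy]; exact: f_anti.
have e : (\int[lebesgue_measure]_(x in `]0%R, y]) f x =
    \int[lebesgue_measure]_(x in `]0%R, (y / 2)%R]) f x +
    \int[lebesgue_measure]_(x in `](y / 2)%R, y]) f x)%E.
  have mU : measurable_fun (`]0%R, y / 2]%classic `|` `]y / 2, y]%classic) f.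
    by rewrite -U; exact: mf.
  rewrite U ge0_integral_setU//; apply/disj_setPS => x [] /=;
    rewrite !in_itv/= => /andP[_ xy] /andP[yx _].
  by move: yx; rewrite ltNge xy.
have := split_scale_integral_fin y; have := split_scale_integral_fin (y / 2).
rewrite /split_scale (min_idPl y2) (min_idPl (_ : y / 2 <= 2^-1)); last by lra.
set S := fine (sigma _).
have SE : sigma `]0%R, y]%classic = S%:E by rewrite /S fineK// fin_num_measure.
have S0 : 0 <= S by rewrite -lee_fin -SE measure_ge0.
have i0 a b : (0 <= \int[lebesgue_measure]_(x in [set` Interval a b]) f x)%E by exact:
  integral_ge0.
rewrite e => f1 f2; move: (f2); rewrite fin_numD f1/= => f3.
have Sp : 0 < S.
  rewrite lt_neqAle S0 andbT; apply/eqP => S0'.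
  move: fy; rewrite /f SE -S0' inve0 gt0_muley ?lte_fin ?divr_gt0// leye_eq => /eqP h.
  by move: f3; rewrite h.
split=> //; move: fy; rewrite /f SE inver gt_eqF// => fy.
rewrite fineD// addrC addKr.
move: fy; rewrite -(fineK f3) -EFinM lee_fin => fy.
by rewrite /= [leRHS]mulrC -ler_pdivrMr.
Qed.

(** Chosen so that [rate] times the gain [(m / 4) / sigma (0, m/2]] of
    [split_scale_step], weighted by the probability [bs Q sigma (0, m/2]] of
    halving the smallest part, is [4 m (bm + bs) Q]. *)
Let rate : R := 16 * (bm + bs) / bs.

Let rate_ge0 : 0 <= rate.
Proof.
case/andP: bm01 => b0 _; case/andP: bs01 => s0 _.
apply: divr_ge0; last exact: ltW.
by apply: mulr_ge0 => //; exact/ltW/addr_gt0.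
Qed.

Definition part_count p : R := fine (num_parts p).

Lemma finite_part_countE n p : finite_partition n p -> part_count p = n%:R.
Proof. by move=> pn; rewrite /part_count /num_parts (finite_part_count pn). Qed.

(** The coefficient 4 makes the decrease of [4 m N] under merging outweigh the
    loss of the whole score when the smallest part is merged. *)
Definition escape_score p : R :=
  1 - rate * split_scale (min_part p / 2) - 4 * min_part p * part_count p.

Definition escape_weight p : \bar R :=
  (\1_(@away R) p * Num.max 0 (escape_score p))%:E.

Lemma escape_weight_ge0 p : (0 <= escape_weight p)%E.
Proof. by rewrite lee_fin mulr_ge0// le_max lexx. Qed.

Lemma part_count_ge0 p : 0 <= part_count p.
Proof. by apply: fine_ge0; apply: part_sum_ge0 => //; exact: part_ge0. Qed.

Lemma escape_weight_le1 p : (escape_weight p <= 1)%E.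
Proof.
rewrite lee_fin mulr_ile1// ?le_max ?lexx// ge_max ler01/=.
have := mulr_ge0 rate_ge0 (split_scale_ge0 (min_part p / 2)).
have := mulr_ge0 (mulr_ge0 (ler0n R 4) (min_part_ge0 p)) (part_count_ge0 p).
by rewrite /escape_score; lra.
Qed.

Lemma measurable_escape_weight : measurable_fun [set: state] escape_weight.
Proof.
apply/measurable_EFinP; apply: measurable_funM.
  by apply: measurable_indic; exact: measurable_away.
have mm := @measurable_min_part R.
apply: measurable_maxr => //; apply: measurable_funB; first apply: measurable_funB => //.
  apply: measurable_funM => //.
  have ms : measurable_fun setT split_scale.
    by apply: nondecreasing_measurable => // x y; exact: split_scale_mono.
  apply: (measurableT_comp ms); exact: measurable_funM.
apply: measurable_funM; first exact: measurable_funM.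
apply: measurableT_comp => //; apply: measurable_state_sum => //.
exact: measurable_positive.
Qed.

Lemma escape_weight_away p : ~ away p -> escape_weight p = 0%E.
Proof. by move=> np; rewrite /escape_weight indicE memNset// mul0r. Qed.

Lemma escape_weight_lower n p (m : R) : (1 < n)%N -> finite_partition n p ->
  min_part p <= m ->
  ((1 - rate * split_scale (m / 2) - 4 * m * n%:R)%:E <= escape_weight p)%E.
Proof.
move=> n1 pn pm; rewrite lee_fin indicE mem_set; last exact: finite_away pn n1.
rewrite mul1r le_max; apply/orP; right; rewrite /escape_score (finite_part_countE pn).
have h1 : split_scale (min_part p / 2) <= split_scale (m / 2).
  by apply: split_scale_mono; lra.
have h2 := ler_wpM2l rate_ge0 h1.
have h3 : 4 * min_part p * n%:R <= 4 * m * n%:R :> R.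
  by rewrite ler_wpM2r// ler_wpM2l.
by lra.
Qed.

(** When the score [V] is positive, [4 m < 1].  A merge that spares the smallest
    part raises the score by at least [4 m]; one that involves it costs at most
    [V < 1]; a split costs at most [4 m], but gains [D] when it at least halves the
    smallest part. *)
Lemma escape_weight_step p : away p -> (escape_weight p <= K escape_weight p)%E.
Proof.
move=> ap; have [n n1 pn] := awayP ap.
have [i0 i0n pi0] := min_part_attained pn.
have K0 := kernel_op_ge0 sigma bm01 bs01 p escape_weight_ge0.
set m := min_part p in pi0.
have p0 : 0 < p i0 by rewrite pn.1.
have m0 : 0 < m by rewrite -pi0.
have m1 : m <= 1 by exact: min_part_le1.
rewrite [leLHS]/escape_weight indicE mem_set// mul1r.
have [V0|V0] := leP (escape_score p) 0; first exact: K0.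
set V := escape_score p in V0 *.
have VE : V = 1 - rate * split_scale (m / 2) - 4 * m * n%:R.
  by rewrite /V /escape_score (finite_part_countE pn).
have s0 := mulr_ge0 rate_ge0 (split_scale_ge0 (m / 2)).
have m4 : 4 * m <= 4 * m * n%:R by rewrite ler_pMr ?mulr_gt0// ler1n ltnW.
have /andP[b0 b1] := bm01; have /andP[t0 t1] := bs01.
have [S0 SW] := @split_scale_step (m / 2) ltac:(lra).
set S := fine _ in S0 SW.
set D := rate * (split_scale (m / 2) - split_scale (m / 2 / 2)).
have D0 : 0 <= D.
  by rewrite mulr_ge0// subr_ge0; apply: split_scale_mono; lra.
have DS : 4 * m * (bm + bs) / bs <= D * S.
  have -> : D * S = rate * (S * (split_scale (m / 2) - split_scale (m / 2 / 2))).
    by rewrite /D; ring.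
  apply: le_trans (ler_wpM2l rate_ge0 SW).
  rewrite /rate le_eqVlt; apply/orP; left; apply/eqP; field.
  by rewrite gt_eqF.
have := @kernel_op_ge R sigma bm bs bm01 bs01 n p escape_weight pn
  escape_weight_ge0 (V + 4 * m) V (fun i => if i == i0 then - (1 + 4 * m) else 0)
  (fun=> V - 4 * m + D * S).
rewrite /drift_bound (sum_single (fun i => p i * (1 - p i)) _ i0n).
have := sqnorm_finite_bounds pn.
set Q := \sum_(i < n) p i ^+ 2 => /andP[Q0 Q1].
rewrite -mulr_suml -/Q pi0 => H; apply: le_trans (H _ _ _).
- rewrite lee_fin.
  have h1 : bs * (Q * (4 * m * (bm + bs) / bs)) <= bs * (Q * (D * S)).
    by apply: ler_wpM2l; [exact: ltW|exact: ler_wpM2l].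
  have h2 : bs * (Q * (4 * m * (bm + bs) / bs)) = Q * (4 * m * (bm + bs)).
    by field; rewrite gt_eqF.
  have h3 : m * (1 - m) * (1 + 4 * m) <= m * 2.
    have m41 : 4 * m < 1 by move: V0; rewrite VE; lra.
    rewrite -mulrA; apply: ler_wpM2l; first exact: ltW.
    by have := mulr_ge0 (ltW m0) (ltW m0); lra.
  have h4 := ler_wpM2l (ltW b0) h3.
  by lra.
- move=> i j ij jn.
  have [ei|ei] := eqVneq i i0.
    apply: le_trans (escape_weight_ge0 _); rewrite lee_fin.
    by case: eqP => _; lra.
  have [ej|ej] := eqVneq j i0.
    by apply: le_trans (escape_weight_ge0 _); rewrite lee_fin; lra.
  have fm : finite_partition n.-1 (merge_parts i j p).
    by apply: finite_merge => //; [exact: ltn_trans jn|rewrite ltn_eqF].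
  have n2 := third_index ij jn i0n ei ej.
  have mm : min_part (merge_parts i j p) <= m.
    by rewrite -pi0; apply: min_part_merge => //;
      [rewrite ltn_eqF|rewrite eq_sym|rewrite eq_sym].
  apply: le_trans (escape_weight_lower _ fm mm); last by case: (n) n2 => [|[|[]]].
  rewrite lee_fin VE; have -> : n%:R = n.-1%:R + 1 :> R by rewrite natr1 prednK// ltnW.
  by lra.
- move=> i ni.
  have := @integral_split_ge R sigma sigma1 escape_weight i p V D (4 * m) (m / 2).
  apply => //.
  + exact: escape_weight_ge0.
  + exact: measurable_escape_weight.
  + exact: ltW.
  + by rewrite mulr_ge0// ltW.
  + by rewrite ler_pdivrMr// mulVf.
  + move=> u uI; have [u0 u2 u01] := in_half uI.
    have pi : 0 < p i by rewrite pn.1.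
    have u1 : 0 < u < 1 by rewrite u0 (le_lt_trans u2)//; lra.
    have fs := finite_split_half pn ni uI.
    have [ml mu] := min_part_split u1 pi p0.
    rewrite -leeBlDr// -EFinB.
    have n11 : (1 < n.+1)%N by exact: ltnW.
    have nS : n.+1%:R = n%:R + 1 :> R by rewrite natr1.
    have [um|um] := boolP (u \in `]0%R, m / 2]).
      have mu' : min_part (split_part i u p) <= m / 2.
        apply: le_trans mu _; move: um; rewrite in_itv/= => /andP[_].
        by apply: le_trans; rewrite ger_pMr// (finite_partition_le1 _ pn).
      rewrite indicE mem_set// mulr1; apply: le_trans (escape_weight_lower n11 fs mu').
      rewrite lee_fin VE nS /D.
      have : 0 <= m * n%:R by rewrite mulr_ge0// ltW.
      by lra.
    rewrite indicE memNset; last by exact/negP.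
    rewrite mulr0 addr0; rewrite pi0 in ml.
    apply: le_trans (escape_weight_lower n11 fs ml).
    by rewrite lee_fin VE nS; lra.
- by rewrite /escape_weight indicE mem_set// mul1r lee_fin le_max lexx orbT.
Qed.

Context (d : measure_display) (T : measurableType d) (P : probability T R)
    (X : nat -> T -> mass_partition R).
Hypothesis chainX : markov_chain (split_merge_kernel sigma bm bs) unit_partition P X.

(** A first split with [u <= e] leads to a state of score at least 1/2. *)
Lemma escape_weight_unit : exists2 c : R, 0 < c & (c%:E <= K escape_weight unit)%E.
Proof.
have /andP[t0 t1] := bs01.
have mfI : measurable_fun (`]0, 2^-1]%classic : set (measurableTypeR R)) f by exact: mf.
have [|k hy] := integral_small_sets (mu := @lebesgue_measure R) (e := (8 * (rate + 1))^-1)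
    (measurable_itv _) (fun n => measurable_itv _) (@near0_sub R) (@near0_dec R)
    (@bigcap_near0 R) f_ge0 mfI sigma_inv.
  by rewrite invr_gt0 mulr_gt0// ltr_wpDl.
have /andP[y0 y2] := near0_half R k; set y := (k.+2%:R^-1 : R) in y0 y2.
have r1 : 0 < rate + 1 by rewrite ltr_wpDl.
have Wy : rate * split_scale y <= 8^-1.
  have : split_scale y <= (8 * (rate + 1))^-1.
    rewrite /split_scale -lee_fin fineK; last exact: split_scale_integral_fin.
    by rewrite (min_idPl y2); exact: ltW.
  move/(ler_wpM2l rate_ge0)/le_trans; apply.
  by rewrite invfM mulrCA ger_pMr ?invr_gt0// ler_pdivrMr//; lra.
pose e := Num.min y 32^-1.
have e0 : 0 < e by rewrite lt_min y0 invr_gt0 ltr0n.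
have ey : e <= y by rewrite ge_min lexx.
have e32 : e <= 32^-1 by rewrite ge_min lexx orbT.
have [S0 _] := @split_scale_step e ltac:(lra).
exists (bs * (2^-1 * fine (sigma `]0%R, e]%classic))).
  by rewrite mulr_gt0// mulr_gt0// invr_gt0.
apply: le_trans (kernel_unit_ge sigma bm01 bs01 escape_weight_ge0).
rewrite EFinM; apply: lee_wpmul2l; first by rewrite lee_fin ltW.
have := @integral_split_ge R sigma sigma1 escape_weight 0 unit 0 2^-1 0 e.
rewrite subr0 add0r; apply => //.
- exact: escape_weight_ge0.
- exact: measurable_escape_weight.
- by apply: le_trans e32 _; lra.
- move=> u uI; have [u0 u2 u01] := in_half uI; rewrite add0r adde0.
  have [ue|ue] := boolP (u \in `]0%R, e]); last first.
    by rewrite indicE memNset ?mulr0 ?escape_weight_ge0//; exact/negP.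
  rewrite indicE mem_set// mulr1.
  have u1' : 0 < u < 1 by rewrite u0 (le_lt_trans u2)//; lra.
  have p0 : 0 < unit 0%N by rewrite /parts/=.
  have [_ mu] := min_part_split u1' p0 p0.
  have mue : min_part (split_part 0 u unit) <= e.
    apply: le_trans mu _; rewrite /parts/= mulr1.
    by move: ue; rewrite in_itv/= => /andP[].
  apply: le_trans (escape_weight_lower (ltnSn 1) (finite_split_half (unit_finite R)
    (ltnSn 0) uI) mue).
  have We : split_scale (e / 2) <= split_scale y by apply: split_scale_mono; lra.
  have := ler_wpM2l rate_ge0 We.
  by rewrite lee_fin; lra.
Qed.

Lemma split_scale_transient : transient P X.
Proof.
have [c c0 cK] := escape_weight_unit.
apply: (transient_excursion bm01 bs01 sigma1 chainX c0) => n.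
have mE m := @measurable_excursion R sigma bm bs d T P X chainX m.
apply: (@le_trans _ _ (P (excursion X n.+1))); last first.
  by apply: le_measure; rewrite ?inE//; move=> w [].
apply: le_trans cK _.
exact: (excursion_subharmonic bm01 bs01 sigma1 chainX (g := fun=> escape_weight)
  (fun=> escape_weight_ge0) (fun=> escape_weight_le1) (fun=> measurable_escape_weight)
  (fun=> escape_weight_away) (fun=> escape_weight_step) n).
Qed.

End transience.

(** * Occupation measures of an excursion *)

Section occupation.
Context (R : realType) (sigma : probability R R) (bm bs : R).
Hypotheses (bm01 : 0 < bm <= 1) (bs01 : 0 < bs <= 1).
Hypothesis sigma1 : sigma (`]0, 2^-1]%classic : set R) = 1%E.
Context (d : measure_display) (T : measurableType d) (P : probability T R)
    (X : nat -> T -> mass_partition R).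
Hypothesis chainX : markov_chain (split_merge_kernel sigma bm bs) unit_partition P X.
Local Notation state := (g_sigma_algebraType (@coord_sets R)).
Local Notation K := (kernel_op sigma bm bs).
Local Notation unit := (@unit_partition R).
Implicit Types (p q : mass_partition R) (f g : mass_partition R -> \bar R).

Definition occupation n f : \bar R :=
  (\sum_(k < n) \int[P]_(w in excursion X k) f (X k w))%E.

Let mE k : measurable (excursion X k).
Proof. exact: (@measurable_excursion R sigma bm bs d T P X chainX k). Qed.

Let mX k F f : measurable_fun [set: state] f -> measurable_fun F (fun w => f (X k w)).
Proof. exact: (measurable_on_chain chainX). Qed.

Lemma occupation_ge0 n f : (forall p, (0 <= f p)%E) -> (0 <= occupation n f)%E.
Proof. by move=> f0; apply: sume_ge0 => k _; exact: integral_ge0. Qed.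

Lemma le_occupation n f g : (forall p, (0 <= f p)%E) -> measurable_fun [set: state] f ->
  measurable_fun [set: state] g ->
  (forall p, proper_partition p -> (f p <= g p)%E) ->
  (occupation n f <= occupation n g)%E.
Proof.
move=> f0 mf mg fg; apply: lee_sum => k _; apply: ge0_le_integral => //; try exact: mX.
by move=> w /excursion_proper; exact: fg.
Qed.

Lemma occupationD n f g : (forall p, (0 <= f p)%E) -> (forall p, (0 <= g p)%E) ->
  measurable_fun [set: state] f -> measurable_fun [set: state] g ->
  (occupation n (fun p => f p + g p) = occupation n f + occupation n g)%E.
Proof.
move=> f0 g0 mf mg; rewrite /occupation -big_split/=; apply: eq_bigr => k _.
by rewrite ge0_integralD//; exact: mX.
Qed.

Lemma occupationZ n (c : R) f : 0 <= c -> (forall p, (0 <= f p)%E) ->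
  measurable_fun [set: state] f ->
  (occupation n (fun p => c%:E * f p) = c%:E * occupation n f)%E.
Proof.
move=> c0 f0 mf; rewrite /occupation ge0_sume_distrr => [|k _]; last exact: integral_ge0.
by apply: eq_bigr => k _; rewrite ge0_integralZl_EFin//; exact: mX.
Qed.

Lemma occupation_sum n (I : Type) (s : seq I) (f : I -> mass_partition R -> \bar R) :
  (forall i p, (0 <= f i p)%E) -> (forall i, measurable_fun [set: state] (f i)) ->
  (occupation n (fun p => \sum_(i <- s) f i p) = \sum_(i <- s) occupation n (f i))%E.
Proof.
move=> f0 mf; rewrite /occupation exchange_big/=; apply: eq_bigr => k _.
by rewrite ge0_integral_sum// => i; exact: mX.
Qed.

Lemma occupation1 n : occupation n (fun=> 1%E) = (\sum_(k < n) P (excursion X k))%E.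
Proof.
by apply: eq_bigr => k _; rewrite integral_cst// mul1e.
Qed.

(** Summing the one-step balance of [f] over the excursion, the term at the end
    is nonnegative and the term at the start is zero. *)
Lemma occupation_drift n f (loss gain : mass_partition R -> \bar R) :
  (forall p, (0 <= f p)%E) -> (forall p, (0 <= loss p)%E) -> (forall p, (0 <= gain p)%E)
    ->
  measurable_fun [set: state] f -> measurable_fun [set: state] loss ->
  measurable_fun [set: state] gain -> (forall p, ~ away p -> f p = 0%E) ->
  (forall p, proper_partition p -> (K f p + loss p <= f p + gain p)%E) ->
  (occupation n loss <= occupation n gain)%E.
Proof.
move=> f0 l0 g0 mf ml mg fa drift.
have mK := measurable_kernel_op sigma bm bs f0 mf.
have K0 p := kernel_op_ge0 sigma bm01 bs01 p f0.
suff : (\int[P]_(w in excursion X n) f (X n w) + occupation n loss <= occupation n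
  gain)%E.
  by apply: le_trans; rewrite leeDr// integral_ge0.
elim: n => [|n IH].
  rewrite /occupation !big_ord0 adde0 (eq_integral (fun=> 0%E)) ?integral0// => w
    /set_mem /= ->.
  by apply: fa => -[_]; apply.
rewrite (excursion_step bm01 bs01 chainX)// /occupation !big_ord_recr/=.
rewrite [X in (_ + X)%E]addeC addeA -ge0_integralD//; try exact: mX.
apply: (@le_trans _ _ (\int[P]_(w in excursion X n) (f (X n w) + gain (X n w)) +
  occupation n loss)%E).
  rewrite leeD2r//; apply: ge0_le_integral => //.
  - by move=> w _; rewrite adde_ge0.
  - by apply: emeasurable_funD; exact: mX.
  - by apply: emeasurable_funD; exact: mX.
  - by move=> w /excursion_proper; exact: drift.
rewrite ge0_integralD//; try exact: mX.
by rewrite addeAC; apply: leeD2r.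
Qed.

Lemma occupation_step n f : (forall p, (0 <= f p)%E) -> measurable_fun [set: state] f ->
  (forall p, ~ away p -> f p = 0%E) -> (occupation n (K f) <= occupation n.+1 f)%E.
Proof.
move=> f0 mf fa; rewrite /occupation big_ord_recl.
under eq_bigr do rewrite -(excursion_step bm01 bs01 chainX)//.
by rewrite leeDr// integral_ge0.
Qed.

(** At most one return ends the excursion: the probability of returning at step
    [n + 1] is at most the drop of the survival probability. *)
Lemma occupation_return n :
  (occupation n (K (fun p => (\1_[set unit] p : R)%:E)) <= 1)%E.
Proof.
have mu := @measurable_unit R.
have m1 : measurable_fun [set: state] (fun p : mass_partition R => (\1_[set unit] p :
  R)%:E).
  by apply/measurable_EFinP; exact: measurable_indic.
suff : (P (excursion X n) + occupation n (K (fun p => (\1_[set unit] p : R)%:E)) <= 1)%E.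
  by apply: le_trans; rewrite leeDr.
elim: n => [|n IH]; first by rewrite /occupation big_ord0 adde0 probability_le1.
apply: le_trans IH; rewrite /occupation big_ord_recr/= addeCA [leRHS]addeC leeD2l//.
rewrite -(chain_step bm01 bs01 chainX (@history_excursion _ _ _ X n))//.
have mXu : measurable (X n.+1 @^-1` [set unit]).
  by rewrite -[X in measurable X]setTI; apply: (measurable_chain chainX).
rewrite [X in (_ + X)%E](_ : _ = P (X n.+1 @^-1` [set unit] `&` excursion X n));
  last first.
  by rewrite -integral_indic.
rewrite -measureU//.
- apply: le_measure; rewrite ?inE//.
    by apply: measurableU; [exact: (mE n.+1)|exact: measurableI].
  by move=> w [[]|[]].
- exact: (mE n.+1).
- exact: measurableI.
- by apply/seteqP; split=> // w [[_ [_ nu]] [+ _]]; exact: nu.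
Qed.

End occupation.

(** * States whose parts are all large *)

Section levels.
Context (R : realType) (sigma : probability R R) (bm bs : R).
Hypotheses (bm01 : 0 < bm <= 1) (bs01 : 0 < bs <= 1).
Hypothesis sigma1 : sigma (`]0, 2^-1]%classic : set R) = 1%E.
Context (d : measure_display) (T : measurableType d) (P : probability T R)
    (X : nat -> T -> mass_partition R).
Hypothesis chainX : markov_chain (split_merge_kernel sigma bm bs) unit_partition P X.
Local Notation state := (g_sigma_algebraType (@coord_sets R)).
Local Notation K := (kernel_op sigma bm bs).
Local Notation unit := (@unit_partition R).
Implicit Types (p q : mass_partition R).

Definition small_part (delta x : R) : R := (0 < x < delta)%R%:R.

Lemma small_part_ge0 delta x : 0 <= small_part delta x. Proof. by []. Qed.

Lemma small_part0 delta : small_part delta 0 = 0.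
Proof. by rewrite /small_part ltxx. Qed.

Lemma measurable_small_part delta : measurable_fun setT (small_part delta).
Proof.
rewrite (_ : small_part delta = \1_(`]0, delta[)) ?measurable_indic//.
by apply/funext => x; rewrite indicE mem_setE in_itv/=.
Qed.

Definition small_count delta p : \bar R := part_sum (small_part delta) p.

Lemma small_count_ge0 delta p : (0 <= small_count delta p)%E.
Proof. by apply: part_sum_ge0 => //; exact: part_ge0. Qed.

Lemma num_parts_ge0 p : (0 <= num_parts p)%E.
Proof. by apply: part_sum_ge0 => //; exact: part_ge0. Qed.

Lemma measurable_small_count delta : measurable_fun [set: state] (small_count delta).
Proof. by apply: measurable_state_sum => //; exact: measurable_small_part. Qed.

Lemma measurable_num_parts : measurable_fun [set: state] (@num_parts R).
Proof. by apply: measurable_state_sum => //; exact: measurable_positive. Qed.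

Variable delta : R.
Hypothesis delta01 : 0 < delta <= 1.

Definition level k : set (mass_partition R) :=
  [set p | finite_partition k p /\ small_count delta p = 0%E].

Lemma measurable_level k : measurable (level k : set state).
Proof.
have h1 := measurable_num_parts measurableT (emeasurable_set1 k%:R%:E).
have h2 := measurable_small_count delta measurableT (emeasurable_set1 0%E).
have := measurableI _ _ (@measurable_proper R) (measurableI _ _ h1 h2).
rewrite !setTI; congr measurable; apply/seteqP; split=> p.
  by move=> [/proper_partitionP[p1 _] [c0 s0]]; split=> //; exact: finite_partitionP.
move=> [pk s0]; split; first by exists k.
by split=> //; exact: finite_part_count pk.
Qed.

Definition level_indic k p : \bar R := (\1_(level k) p : R)%:E.

Lemma level_indic_ge0 k p : (0 <= level_indic k p)%E.
Proof. by rewrite lee_fin. Qed.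

Lemma measurable_level_indic k : measurable_fun [set: state] (level_indic k).
Proof. by apply/measurable_EFinP; apply: measurable_indic; exact: measurable_level. Qed.

Lemma level_part_ge k p i : level k p -> (i < k)%N -> delta <= p i.
Proof.
move=> [pk s0] ik; rewrite leNgt; apply/negP => pid.
have : ((small_part delta (p i))%:E <= small_count delta p)%E.
  rewrite /small_count /part_sum (nneseriesD1 (n := i))//; last first.
    by move=> j _; rewrite lee_fin.
  by rewrite leeDl// nneseries_ge0// => j _ _; rewrite lee_fin.
by rewrite s0 lee_fin /small_part pid pk.1 ik ler10.
Qed.

Lemma level_merge k p i j : level k p -> (i < j)%N -> (j < k)%N ->
  level k.-1 (merge_parts i j p).
Proof.
move=> pl ij jk; have [pk s0] := pl; have ik := ltn_trans ij jk.
have nij : i != j by rewrite ltn_eqF.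
split; first exact: finite_merge.
have := @part_sum_merge R (small_part delta) i j p nij (fun _ _ => small_part_ge0 _ _)
  (small_part0 _).
have pi := level_part_ge pl ik; have pj := level_part_ge pl jk.
rewrite -/(small_count delta p) s0 /small_part (le_gtF pi) (le_gtF pj) !andbF !adde0.
have : delta <= p i + p j by rewrite (le_trans pi)// lerDl part_ge0.
by move=> /le_gtF ->; rewrite andbF add0e.
Qed.

(** Any merge leads to the next level down.  The probability of a merge is
    [bm (1 - Q)], and [1 - Q >= 1 - p 0 >= p 1 >= delta]. *)
Lemma level_step k p : level k.+2 p -> ((bm * delta)%:E <= K (level_indic k.+1) p)%E.
Proof.
move=> pl; have [pk s0] := pl.
have /andP[b0 b1] := bm01.
have := @kernel_op_ge R sigma bm bs bm01 bs01 k.+2 p (level_indic k.+1) pk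
  (level_indic_ge0 k.+1) 1 0 (fun=> 0) (fun=> 0).
rewrite /drift_bound; set Q := \sum_(i < k.+2) p i ^+ 2 => H.
apply: le_trans (H _ _ _) => {H}.
- rewrite [X in 2 * X]big1; last by move=> i _; rewrite mulr0.
  rewrite [X in bs * X]big1; last by move=> i _; rewrite mulr0.
  rewrite !mulr0 !addr0 mul1r lee_fin; apply: ler_wpM2l; first exact: ltW.
  have Qp : Q <= p 0%N.
    rewrite -[leRHS]mulr1 -pk.2 mulr_sumr; apply: ler_sum => i _.
    by rewrite expr2 ler_wpM2r ?part_ge0// part_noninc.
  have p1 := level_part_ge pl (isT : (1 < k.+2)%N).
  have := pk.2; rewrite !big_ord_recl/=.
  have : 0 <= \sum_(i < k) p (bump 0 (bump 0 i)) by apply: sumr_ge0 => i _;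
    exact: part_ge0.
  rewrite /bump/= addn0. lra.
- by move=> i j ij jk; rewrite !addr0 /level_indic indicE mem_set//;
  exact: (level_merge pl ij jk).
- by move=> i ik; apply: integral_ge0 => u _; exact: level_indic_ge0.
- exact: level_indic_ge0.
Qed.

Lemma level_away k p : level k.+2 p -> away p.
Proof. by move=> [pk _]; exact: finite_away pk _. Qed.

Let B : R := (bm * delta)^-1.

Let bmd : 0 < bm * delta.
Proof. by case/andP: bm01 => ? _; case/andP: delta01 => ? _; rewrite mulr_gt0. Qed.

Let mK f : (forall p, (0 <= f p)%E) -> measurable_fun [set: state] f ->
  measurable_fun [set: state] (K f).
Proof. exact: (@measurable_kernel_op R sigma bm bs f). Qed.

Lemma level_outflow n k :
  (occupation P X n (level_indic k.+2) <= B%:E * occupation P X n (K (level_indic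
    k.+1)))%E.
Proof.
have K0 p := kernel_op_ge0 sigma bm01 bs01 p (level_indic_ge0 k.+1).
rewrite lee_pdivlMl// -(occupationZ chainX)//; last 3 first.
- exact: ltW.
- exact: level_indic_ge0.
- exact: measurable_level_indic.
apply: (le_occupation chainX).
- by move=> p; apply: mule_ge0; [rewrite lee_fin ltW|exact: level_indic_ge0].
- by apply: emeasurable_funM => //; exact: measurable_level_indic.
- exact: (mK (level_indic_ge0 _) (@measurable_level_indic _)).
- move=> p _; rewrite /level_indic indicE; case: (boolP (p \in level k.+2)) => [/set_mem
  pl|_].
    by rewrite mule1; exact: level_step.
  by rewrite mule0.
Qed.

(** Entering a level above the lowest means spending a step there, and each such
    step descends with probability at least [bm * delta]; so the inflow grows by
    at most a factor [B] per level.  At the lowest level the inflow is the return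
    itself. *)
Lemma level_inflow k n :
  (occupation P X n (K (level_indic k.+1)) <= (B ^+ k)%:E)%E.
Proof.
elim: k n => [|k IH] n.
  apply: le_trans (occupation_return bm01 bs01 chainX n).
  rewrite (_ : level_indic 1 = (fun p => (\1_[set unit] p : R)%:E))//.
  apply/funext => p; rewrite /level_indic; congr (\1_ _ _)%:E; apply/seteqP; split=> q.
    by move=> [q1 _]; exact: finite_partition1.
  move=> ->; split; first exact: unit_finite.
  rewrite /small_count (finite_part_sum (unit_finite R))//; last exact: small_part0.
  rewrite big_ord1 /small_part /parts/= ltr01/= ltNge.
  by case/andP: delta01 => _ ->.
apply: le_trans (@occupation_step R sigma bm bs bm01 bs01 d T P X chainX n _
  (level_indic_ge0 _) (@measurable_level_indic _) _) _.
  move=> p np; rewrite /level_indic indicE memNset// => /level_away; exact: np.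
apply: le_trans (level_outflow n.+1 k) _.
rewrite exprS EFinM; apply: lee_wpmul2l; last exact: IH.
by rewrite lee_fin invr_ge0 ltW.
Qed.

Lemma level1_occupation n : (occupation P X n (level_indic 1) <= 1)%E.
Proof.
case: n => [|n]; first by rewrite /occupation big_ord0.
rewrite /occupation big_ord_recl [X in (_ + X)%E]big1 ?adde0 /=.
  apply: (@le_trans _ _ (\int[P]_(w in excursion X 0) 1)%E).
    have m0 := @measurable_excursion R sigma bm bs d T P X chainX 0.
    apply: ge0_le_integral => //.
    - by move=> w _; exact: level_indic_ge0.
    - by apply: (measurable_on_chain chainX); exact: measurable_level_indic.
    - by move=> w _; rewrite lee_fin indicE; case: (_ \in _).
  rewrite integral_cst; last exact: (@measurable_excursion R sigma bm bs d T P X chainX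
    0).
  by rewrite mul1e probability_le1//; exact: (@measurable_excursion R sigma bm bs d T P X
    chainX 0).
move=> i _; rewrite (eq_integral (fun=> 0%E)) ?integral0// => w /set_mem /= [_ [_ nu]].
rewrite /level_indic indicE memNset// => -[w1 _]; apply: nu.
exact: finite_partition1.
Qed.

Lemma level_occupation k n : (occupation P X n (level_indic k.+1) <= (B ^+ k)%:E)%E.
Proof.
case: k => [|k]; first exact: level1_occupation.
apply: le_trans (level_outflow n k) _.
rewrite exprS EFinM; apply: lee_wpmul2l; last exact: level_inflow.
by rewrite lee_fin invr_ge0 ltW.
Qed.

End levels.

(** * Small parts are rare *)

Section small_parts.
Context (R : realType) (sigma : probability R R) (bm bs : R).
Hypotheses (bm01 : 0 < bm <= 1) (bs01 : 0 < bs <= 1).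
Hypothesis sigma1 : sigma (`]0, 2^-1]%classic : set R) = 1%E.
Hypothesis sigma_inv : (\int[sigma]_(x in `]0%R, 2^-1%R]) (x^-1)%:E < +oo)%E.
Local Notation state := (g_sigma_algebraType (@coord_sets R)).
Local Notation K := (kernel_op sigma bm bs).
Local Notation I := (`]0, 2^-1%R]%classic : set R).
Local Notation unit := (@unit_partition R).
Implicit Types (p q : mass_partition R).

Let inv (x : R) : \bar R := `|x^-1|%:E.

Let inv_ge0 x : (0 <= inv x)%E.
Proof. by rewrite lee_fin. Qed.

Let invE x : 0 < x -> inv x = (x^-1)%:E.
Proof. by move=> x0; rewrite /inv ger0_norm// invr_ge0 ltW. Qed.

Let measurable_inv b (y : R) : measurable_fun [set` Interval (BRight 0) (BSide b y)] inv.
Proof.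
apply: nonincreasing_emeasurable => [|s t]; first exact: interval_is_interval.
rewrite /= !in_itv/= => /andP[s0 _] /andP[t0 _] st.
by rewrite !invE// lee_fin lef_pV2.
Qed.

(** The part of the inverse moment of [sigma] that comes from splits with
    [u <= y]. *)
Definition small_split (y : R) : R :=
  fine (\int[sigma]_(x in `]0%R, (Num.min y 2^-1)%R]) inv x)%E.

Lemma small_split_fin y :
  (\int[sigma]_(x in `]0%R, (Num.min y 2^-1)%R]) inv x)%E \is a fin_num.
Proof.
rewrite ge0_fin_numE; last exact: integral_ge0.
apply: le_lt_trans sigma_inv.
rewrite [leRHS](eq_integral inv); last by move=> x /set_mem /in_half[x0 _ _];
  rewrite invE.
apply: ge0_subset_integral => //.
by apply/subset_itvl; rewrite bnd_simp ge_min lexx orbT.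
Qed.

Lemma small_split_mono x y : x <= y -> small_split x <= small_split y.
Proof.
move=> xy; apply: fine_le; try exact: small_split_fin.
apply: ge0_subset_integral => //.
by apply/subset_itvl; rewrite bnd_simp le_min !ge_min xy lexx !orbT.
Qed.

Lemma small_split_ge0 y : 0 <= small_split y.
Proof. by apply: fine_ge0; exact: integral_ge0. Qed.

Lemma small_split_le y : small_split y <= small_split 2^-1.
Proof.
rewrite [leLHS](_ : _ = small_split (Num.min y 2^-1)); last first.
  by rewrite /small_split -minA minxx.
by apply: small_split_mono; rewrite ge_min lexx orbT.
Qed.

Lemma small_split_near0 e : 0 < e -> exists2 y, 0 < y & small_split y <= e.
Proof.
move=> e0.
have fin : (\int[sigma]_(x in I) inv x < +oo)%E.
  by have := small_split_fin 2^-1; rewrite minxx ge0_fin_numE// integral_ge0.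
have [k ye] := integral_small_sets (mu := sigma) (measurable_itv _)
  (fun n => measurable_itv _) (@near0_sub R) (@near0_dec R) (@bigcap_near0 R)
  inv_ge0 (@measurable_inv false 2^-1) fin e0.
have /andP[y0 y2] := near0_half R k; set y := (k.+2%:R^-1 : R) in y0 y2.
exists y => //; rewrite /small_split -lee_fin fineK; last exact: small_split_fin.
by rewrite (min_idPl y2) ltW.
Qed.

Lemma integral_split_le (f : mass_partition R -> \bar R) i p (c k y : R) :
  (forall q, (0 <= f q)%E) -> measurable_fun [set: state] f ->
  0 <= c -> 0 <= k ->
  (forall u, I u -> (f (split_part i u p) <= (c + k * (u^-1 * \1_(`]0%R, y]%classic : set
    R) u))%:E)%E) ->
  (\int[sigma]_(u in I) f (split_part i u p) <= (c + k * small_split y)%:E)%E.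
Proof.
move=> f0 mf c0 k0 h.
have m1 : measurable_fun I (fun u : R => (inv u * (\1_(`]0%R, y]%classic : set R)
  u)%:E)%E).
  apply: emeasurable_funM; first exact: (@measurable_inv false _).
  by apply/measurable_EFinP; apply: measurable_funTS; exact: measurable_indic.
have n1 u : (0 <= inv u * (\1_(`]0%R, y]%classic : set R) u)%:E)%E.
  by rewrite mule_ge0// lee_fin.
apply: (@le_trans _ _ (\int[sigma]_(u in I) (c%:E + k%:E * (inv u * (\1_(`]0%R,
  y]%classic : set R) u)%:E)))%E).
  rewrite integral_split_clamp; apply: ge0_le_integral => //.
  - by apply: measurable_funTS; exact: measurable_split_u.
  - by apply: emeasurable_funD => //; apply: emeasurable_funM.
  - move=> u uI; have [u0 _ u01] := in_half uI.
    by rewrite clamp_id// invE// -!EFinM -EFinD; exact: h.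
rewrite ge0_integralD//; last 2 first.
- by move=> u _; apply: mule_ge0.
- by apply: emeasurable_funM.
rewrite integral_half_cst// ge0_integralZl_EFin// EFinD EFinM leeD2l//.
apply: lee_wpmul2l; first by rewrite lee_fin.
rewrite /small_split fineK; last exact: small_split_fin.
rewrite le_eqVlt; apply/orP; left; apply/eqP.
rewrite [LHS]integral_mkcond [RHS]integral_mkcond; apply: eq_integral => u _.
rewrite !patchE indicE; case: ifPn => uI.
  have [u0 u2 _] := in_half (set_mem uI).
  have -> : (u \in `]0%R, (Num.min y 2^-1)%R]%classic) = (u \in `]0%R, y]%classic).
    by rewrite !mem_setE !in_itv/= le_min u2 andbT.
  by case: ifP => _; rewrite ?mule1 ?mule0.
rewrite memNset// => /= uI'; move/negP: uI; apply; apply/mem_set; move: uI'.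
by rewrite /= !in_itv/= le_min => /andP[-> /andP[_ ->]].
Qed.

Section drift.
Variable delta : R.
Hypothesis delta2 : 0 < delta <= 2^-1.

(** The weight [1/x] compensates the probability, of order [x], that a part of
    size [x] is merged. *)
Definition small_inv (x : R) : R := if 0 < x < delta then x^-1 else 0.

Lemma small_inv_ge0 x : 0 <= small_inv x.
Proof. by rewrite /small_inv; case: ifP => // /andP[x0 _]; rewrite invr_ge0 ltW. Qed.

Lemma small_inv0 : small_inv 0 = 0.
Proof. by rewrite /small_inv ltxx. Qed.

Lemma small_inv_anti x y : 0 < x -> x <= y -> small_inv y <= small_inv x.
Proof.
move=> x0 xy; rewrite /small_inv x0 (lt_le_trans x0 xy)/=.
case: ltP => yd; last by case: ifP => _ //; rewrite invr_ge0 ltW.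
by rewrite (le_lt_trans xy yd) lef_pV2// posrE (lt_le_trans x0).
Qed.

Lemma measurable_small_inv : measurable_fun setT small_inv.
Proof.
apply/measurable_EFinP.
rewrite (_ : EFin \o small_inv = (inv \_ `]0%R, delta[%classic)%E).
  by apply/(measurable_restrictT _ _).1 => //; exact: (@measurable_inv false _).
apply/funext => x; rewrite patchE mem_setE in_itv/= /small_inv.
by case: ifP => // /andP[x0 _]; rewrite invE.
Qed.

Definition inv_sum p : \bar R := ((\1_(@proper_partition R) p)%:E * part_sum small_inv
  p)%E.

Lemma inv_sum_ge0 p : (0 <= inv_sum p)%E.
Proof.
rewrite mule_ge0// ?lee_fin// part_sum_ge0//; first exact: part_ge0.
by move=> x _; exact: small_inv_ge0.
Qed.

Lemma measurable_inv_sum : measurable_fun [set: state] inv_sum.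
Proof.
apply: emeasurable_funM.
  by apply/measurable_EFinP; apply: measurable_indic; exact: measurable_proper.
apply: measurable_state_sum; first exact: measurable_small_inv.
by move=> x _; exact: small_inv_ge0.
Qed.

Lemma inv_sum_finite n p : finite_partition n p ->
  inv_sum p = (\sum_(i < n) small_inv (p i))%:E.
Proof.
move=> pn; rewrite /inv_sum indicE mem_set ?mul1e; last by exists n.
apply: finite_part_sum pn _ small_inv0 => x _; exact: small_inv_ge0.
Qed.

Lemma inv_sum_away p : ~ away p -> inv_sum p = 0%E.
Proof.
move=> np; have [pp|pp] := pselect (proper_partition p); last first.
  by rewrite /inv_sum indicE memNset ?mul0e.
have -> : p = unit by apply: contrapT => pu; apply: np.
rewrite (inv_sum_finite (unit_finite R)) big_ord1 /small_inv /parts/= ltr01/=.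
by rewrite ltNge (_ : delta <= 1)//; case/andP: delta2 => _ h; lra.
Qed.

Definition split_gain n p : R := \sum_(i < n) p i * small_split (delta / p i).

(** As [small_inv] is nonincreasing, merging [i] and [j] removes at least half of
    [small_inv (p i) + small_inv (p j)].  Splitting [i] at [u] adds at most
    [2 / (u p i)], and only if [u < delta / p i]. *)
Lemma inv_sum_drift n p : finite_partition n p ->
  (K inv_sum p + ((bm / 2)%:E * small_count delta p) <=
   inv_sum p + (2 * split_gain n p)%:E)%E.
Proof.
move=> pn.
have /andP[b0 b1] := bm01; have /andP[t0 t1] := bs01; have /andP[d0 d2] := delta2.
set S := \sum_(i < n) small_inv (p i).
have S0 : 0 <= S by apply: sumr_ge0 => i _; exact: small_inv_ge0.
have Sp : part_sum small_inv p = S%:E.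
  by apply: (finite_part_sum pn _ small_inv0) => x _; exact: small_inv_ge0.
have fi0 x : 0 <= x -> 0 <= small_inv x by move=> _; exact: small_inv_ge0.
have := @kernel_op_le R sigma bm bs bm01 bs01 n p inv_sum pn inv_sum_ge0 S S
  (fun i => - (small_inv (p i) / 2)) (fun i => S + 2 / p i * small_split (delta / p i)).
rewrite /drift_bound.
have := sqnorm_finite_bounds pn.
set Q := \sum_(i < n) p i ^+ 2 => /andP[Q0 Q1] H.
have -> : small_count delta p = (\sum_(i < n) small_part delta (p i))%:E.
  by apply: (finite_part_sum pn _ (small_part0 _)).
apply: le_trans (leeD2r _ (H _ _ _)) _ => {H}.
- move=> i j ij jn; have nij : i != j by rewrite ltn_eqF.
  have pi : 0 < p i by rewrite pn.1 (ltn_trans ij).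
  have pj : 0 < p j by rewrite pn.1.
  have fm := finite_merge pn (ltn_trans ij jn) jn nij.
  have := part_sum_merge p nij fi0 small_inv0.
  rewrite Sp (inv_sum_finite fm) (finite_part_sum fm fi0 small_inv0).
  rewrite -!EFinD lee_fin => -[].
  have h1 : small_inv (p i + p j) <= small_inv (p i).
    by apply: small_inv_anti => //; rewrite lerDl ltW.
  have h2 : small_inv (p i + p j) <= small_inv (p j).
    by apply: small_inv_anti => //; rewrite lerDr ltW.
  by lra.
- move=> i ni; have pi : 0 < p i by rewrite pn.1.
  apply: integral_split_le => //.
  + exact: inv_sum_ge0.
  + exact: measurable_inv_sum.
  + by rewrite divr_ge0// ltW.
  move=> u uI; have [u0 u2 u01] := in_half uI.
  have fs := finite_split_half pn ni uI.
  have := part_sum_split i p u01 fi0 small_inv0.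
  rewrite Sp (inv_sum_finite fs) (finite_part_sum fs fi0 small_inv0).
  rewrite -!EFinD lee_fin => -[].
  have h1 : small_inv ((1 - u) * p i) <= small_inv (u * p i).
    apply: small_inv_anti; first exact: mulr_gt0.
    by apply: ler_wpM2r; [exact: ltW|lra].
  have h2 := small_inv_ge0 (p i).
  have h3 : small_inv (u * p i) <= (p i)^-1 * (u^-1 * \1_(`]0%R, (delta / p i)]%classic :
    set R) u).
    rewrite /small_inv mulr_gt0//=; case: ifPn => ud; last first.
      by apply: mulr_ge0; [|apply: mulr_ge0 => //]; rewrite invr_ge0; exact: ltW.
    rewrite indicE mem_set; last by rewrite /= in_itv/= u0/= ler_pdivlMr// ltW.
    by rewrite mulr1 invfM mulrC.
  by rewrite -mulrA; lra.
- by rewrite (inv_sum_finite pn).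
- rewrite (inv_sum_finite pn) -/S -EFinM -!EFinD lee_fin.
  have -> : \sum_(i < n) p i * (1 - p i) * - (small_inv (p i) / 2) =
     - (\sum_(i < n) p i * (1 - p i) * small_inv (p i)) / 2.
    by rewrite -sumrN mulr_suml; apply: eq_bigr => i _; ring.
  have -> : \sum_(i < n) p i ^+ 2 * (S + 2 / p i * small_split (delta / p i)) =
      Q * S + 2 * split_gain n p.
    rewrite /Q /split_gain mulr_suml mulr_sumr -big_split/=; apply: eq_bigr => i _.
    have pi : 0 < p i by rewrite pn.1.
    by field; rewrite gt_eqF.
  have G0 : 0 <= split_gain n p.
    by apply: sumr_ge0 => i _; rewrite mulr_ge0 ?part_ge0// small_split_ge0.
  have L : (\sum_(i < n) small_part delta (p i)) / 2 <= \sum_(i < n) p i * (1 - p i) *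
    small_inv (p i).
    rewrite mulr_suml; apply: ler_sum => i _.
    rewrite /small_part /small_inv; case: ifPn => [/andP[pi pd]|_];
      last by rewrite mul0r mulr0.
    rewrite mulrAC divff ?gt_eqF// mul1r; lra.
  have h1 := ler_wpM2l (ltW b0) L.
  have h2 : bs * (2 * split_gain n p) <= 1 * (2 * split_gain n p).
    by apply: ler_wpM2r => //; apply: mulr_ge0.
  by lra.
Qed.

(** The parts above [e] only produce parts below [delta] by splits with
    [u < delta / e]; each part below [e] contributes at most [e] times the whole
    inverse moment. *)
Lemma split_gain_le n p e : finite_partition n p -> 0 < e ->
  split_gain n p <= small_split (delta / e) + small_split 2^-1 * e * n%:R.
Proof.
move=> pn e0; have /andP[d0 d2] := delta2.
have -> : small_split (delta / e) + small_split 2^-1 * e * n%:R =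
    \sum_(i < n) (p i * small_split (delta / e) + small_split 2^-1 * e).
  by rewrite big_split/= -mulr_suml pn.2 mul1r sumr_const card_ord mulr_natr.
apply: ler_sum => i _; have pi : 0 < p i by rewrite pn.1.
have [pe|pe] := leP e (p i).
  rewrite -[leLHS]addr0 lerD//; last by rewrite mulr_ge0 ?small_split_ge0// ltW.
  apply: ler_wpM2l; first exact: ltW.
  by apply: small_split_mono; apply: ler_wpM2l; [exact: ltW|rewrite lef_pV2].
rewrite -[leLHS]add0r lerD//; first by rewrite mulr_ge0 ?small_split_ge0// ltW.
rewrite mulrC; apply: ler_pM => //; [exact: small_split_ge0|exact: ltW|exact:
  small_split_le|exact: ltW].
Qed.

Lemma split_gain_le_cst n p : finite_partition n p -> split_gain n p <= small_split 2^-1.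
Proof.
move=> pn; have -> : small_split 2^-1 = \sum_(i < n) p i * small_split 2^-1.
  by rewrite -mulr_suml pn.2 mul1r.
apply: ler_sum => i _.
by apply: ler_wpM2l; [exact: part_ge0|exact: small_split_le].
Qed.

End drift.

End small_parts.

(** * A finite inverse moment gives positive recurrence *)

Section sufficiency.
Context (R : realType) (sigma : probability R R) (bm bs : R).
Hypotheses (bm01 : 0 < bm <= 1) (bs01 : 0 < bs <= 1).
Hypothesis sigma1 : sigma (`]0, 2^-1]%classic : set R) = 1%E.
Hypothesis sigma_inv : (\int[sigma]_(x in `]0%R, 2^-1%R]) (x^-1)%:E < +oo)%E.
Context (d : measure_display) (T : measurableType d) (P : probability T R)
    (X : nat -> T -> mass_partition R).
Hypothesis chainX : markov_chain (split_merge_kernel sigma bm bs) unit_partition P X.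
Local Notation state := (g_sigma_algebraType (@coord_sets R)).
Local Notation K := (kernel_op sigma bm bs).
Implicit Types (p q : mass_partition R).

Let C := small_split sigma 2^-1.
Let duration n := \sum_(k < n) fine (P (excursion X k)).

Let C0 : 0 <= C. Proof. exact: small_split_ge0. Qed.

Let durationE n : occupation P X n (fun=> 1%E) = (duration n)%:E.
Proof.
rewrite (occupation1 chainX) /duration -sumEFin; apply: eq_bigr => k _.
have mE := @measurable_excursion R sigma bm bs d T P X chainX k.
by rewrite fineK// fin_num_measure.
Qed.

Let duration_ge0 n : 0 <= duration n.
Proof. by rewrite -lee_fin -durationE occupation_ge0. Qed.

Let occupation_cst n (c : R) : 0 <= c ->
  occupation P X n (fun=> c%:E) = (c * duration n)%:E.
Proof.
move=> c0; rewrite EFinM -durationE -(occupationZ chainX)//.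
by under [in RHS]eq_fun do rewrite mule1.
Qed.

Lemma small_count_occupation n delta (a b : R) : 0 < delta <= 2^-1 -> 0 <= a -> 0 <= b ->
  (forall k p, finite_partition k p -> split_gain sigma delta k p <= a + b * k%:R) ->
  (occupation P X n (small_count delta) <=
    (4 / bm)%:E * ((a * duration n)%:E + b%:E * occupation P X n (@num_parts R)))%E.
Proof.
move=> d2 a0 b0 hgain; have /andP[m0 m1] := bm01.
have mc := @measurable_num_parts R.
have mb : measurable_fun [set: state] (fun p : mass_partition R => b%:E * num_parts p)%E.
  exact: emeasurable_funM.
have b0' p : (0 <= b%:E * num_parts p)%E by rewrite mule_ge0 ?num_parts_ge0.
have ab0 p : (0 <= a%:E + b%:E * num_parts p)%E by rewrite adde_ge0.
have mab : measurable_fun [set: state] (fun p : mass_partition R => a%:E + b%:E *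
  num_parts p)%E.
  exact: emeasurable_funD.
have ms := @measurable_small_count R delta.
have s0 p := small_count_ge0 delta p.
have bm2 : 0 <= bm / 2 by rewrite divr_ge0// ltW.
have := @occupation_drift R sigma bm bs bm01 bs01 d T P X chainX n (inv_sum delta)
  (fun p => (bm / 2)%:E * small_count delta p)%E
  (fun p => 2%:E * (a%:E + b%:E * num_parts p))%E.
rewrite (occupationZ chainX)// (occupationZ chainX)// (occupationD chainX)//.
rewrite (occupationZ chainX)//; last by move=> p; exact: num_parts_ge0.
rewrite occupation_cst// => H.
(* the factor 2 of the gain divided by the factor bm / 2 of the loss *)
have -> : (4 / bm)%:E = ((bm / 2)^-1%:E * 2%:E :> \bar R)%E.
  by rewrite -EFinM; congr EFin; field; rewrite gt_eqF.
rewrite -muleA lee_pdivlMl ?divr_gt0//; apply: H => //.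
- by move=> p; exact: inv_sum_ge0.
- by move=> p; rewrite mule_ge0.
- by move=> p; rewrite mule_ge0.
- exact: measurable_inv_sum.
- exact: emeasurable_funM.
- exact: emeasurable_funM.
- by move=> p; exact: inv_sum_away.
- move=> p [k pk]; apply: le_trans (inv_sum_drift bm01 bs01 sigma1 sigma_inv d2 pk) _.
  rewrite leeD2l// [num_parts p](finite_part_count pk) -!EFinM lee_fin.
  by rewrite ler_wpM2l// hgain.
Qed.

(** At most two parts are not below 1/2, and the number of those that are is
    controlled by [small_count_occupation]. *)
Lemma num_parts_occupation n :
  (occupation P X n (@num_parts R) <= ((4 / bm * C + 2) * duration n)%:E)%E.
Proof.
have half : 0 < (2^-1 : R) <= 2^-1 by rewrite invr_gt0 ltr0n lexx.
have gain k p : finite_partition k p -> split_gain sigma 2^-1 k p <= C + 0 * k%:R.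
  by move=> pk; rewrite mul0r addr0; exact: split_gain_le_cst.
have := small_count_occupation n half C0 (lexx 0) gain.
rewrite mul0e adde0 -EFinM => h.
have ms := @measurable_small_count R 2^-1.
have s0 p := small_count_ge0 2^-1 p.
apply: (@le_trans _ _ (occupation P X n (fun p => small_count 2^-1 p + 2%:E)%E)).
  apply: (le_occupation chainX).
  - by move=> p; exact: num_parts_ge0.
  - exact: measurable_num_parts.
  - exact: emeasurable_funD.
  move=> p [k pk]; rewrite [num_parts p](finite_part_count pk).
  rewrite /small_count (finite_part_sum pk)//; last exact: small_part0.
  rewrite -EFinD lee_fin.
  apply: (@le_trans _ _ (\sum_(i < k) (small_part 2^-1 (p i) + 2 * p i))); last first.
    by rewrite big_split/= -mulr_sumr pk.2 mulr1.
  rewrite -[leLHS]/(1 *+ k) -[k in leLHS]card_ord -sumr_const; apply: ler_sum => i _.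
  have pi : 0 < p i by rewrite pk.1.
  by rewrite /small_part pi/=; case: ltP => /= ?; lra.
rewrite (occupationD chainX)// occupation_cst//.
apply: le_trans (leeD2r _ h) _; rewrite -EFinD lee_fin; lra.
Qed.

(** The length of the excursion is at most the time spent on the levels up to
    [N0], plus a quarter of itself for the presence of a part below [delta], plus
    a quarter of itself for having more than [N0] parts. *)
Lemma duration_bound : exists M : R, forall n, duration n <= M.
Proof.
have /andP[m0 m1] := bm01.
pose C2 := 4 / bm * C + 2.
have C20 : 0 <= C2 by rewrite addr_ge0// mulr_ge0// divr_ge0// ltW.
(* makes the contribution C e C2 of the parts below e at most bm / 32; the
   constant 1 only keeps the denominator positive *)
pose e := bm / (32 * (C * C2 + 1)).
have CC0 : 0 <= C * C2 by exact: mulr_ge0.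
have e0 : 0 < e by rewrite divr_gt0// mulr_gt0// ltr_wpDl.
have [y y0 Jy] := small_split_near0 sigma_inv (divr_gt0 m0 (ltr0n R 32 : 0 < 32%:R)).
pose delta := Num.min 2^-1 (e * y).
have d2 : 0 < delta <= 2^-1.
  by rewrite lt_min invr_gt0 ltr0n mulr_gt0//= ge_min lexx.
have dey : delta / e <= y by rewrite ler_pdivrMr// mulrC ge_min lexx orbT.
have gain k p : finite_partition k p ->
    split_gain sigma delta k p <= bm / 32 + C * e * k%:R.
  move=> pk; apply: le_trans (split_gain_le sigma_inv d2 pk e0) _.
  rewrite lerD2r; apply: le_trans Jy; exact: small_split_mono.
have m32 : 0 <= bm / 32 by rewrite divr_ge0// ltW.
have Ce : 0 <= C * e by rewrite mulr_ge0// ltW.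
have Ce2 : C * e * C2 <= bm / 32.
  rewrite /e [leLHS](_ : _ = bm / 32 * (C * C2 / (C * C2 + 1))); last first.
    by field; rewrite gt_eqF// ltr_wpDl.
  by rewrite ger_pMr ?divr_gt0// ler_pdivrMr ?ltr_wpDl//; lra.
(* large enough for C2 / N0 <= 1/4 *)
pose N0 := (Num.bound (4 * C2)).+1.
have N0C : C2 / N0%:R <= 4^-1.
  rewrite ler_pdivrMr// mulrC ler_pdivlMr// mulrC.
  apply: (@le_trans _ _ (Num.bound (4 * C2))%:R); last by rewrite ler_nat.
  by apply/ltW/archi_boundP; rewrite mulr_ge0.
pose B := (bm * delta)^-1.
pose M := \sum_(k < N0) B ^+ k.
exists (2 * M) => n.
have hs : (occupation P X n (small_count delta) <= (4^-1 * duration n)%:E)%E.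
  apply: le_trans (small_count_occupation n d2 m32 Ce gain) _.
  apply: (@le_trans _ _ ((4 / bm)%:E * ((bm / 32 * duration n)%:E +
      (C * e)%:E * (C2 * duration n)%:E)))%E.
    apply: lee_wpmul2l; first by rewrite lee_fin divr_ge0// ltW.
    rewrite leeD2l//; apply: lee_wpmul2l; [by rewrite lee_fin|exact:
      num_parts_occupation].
  rewrite -!EFinM lee_fin [C * e * _]mulrA -mulrDl mulrA; apply: ler_wpM2r => //.
  apply: (@le_trans _ _ (4 / bm * (bm / 32 + bm / 32))).
    by apply: ler_wpM2l; [rewrite divr_ge0// ltW|rewrite lerD2l].
  rewrite le_eqVlt; apply/orP; left; apply/eqP; field.
  by rewrite gt_eqF.
have d1 : 0 < delta <= 1 by case/andP: d2 => -> h /=; lra.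
have mlev k := @measurable_level_indic R delta k.
have lev0 k p := level_indic_ge0 delta k p.
have mc := @measurable_num_parts R.
have c0 p := @num_parts_ge0 R p.
have Ni : 0 <= (N0%:R^-1 : R) by rewrite invr_ge0.
have ms := @measurable_small_count R delta.
have s0 p := small_count_ge0 delta p.
have mS : measurable_fun [set: state] (fun p : mass_partition R =>
    \sum_(k < N0) level_indic delta k.+1 p)%E by exact: emeasurable_sum.
have S0 p : (0 <= \sum_(k < N0) level_indic delta k.+1 p)%E by exact: sume_ge0.
have mN : measurable_fun [set: state] (fun p : mass_partition R =>
    (N0%:R^-1)%:E * num_parts p)%E by exact: emeasurable_funM.
have cover : ((duration n)%:E <= occupation P X n (fun p =>
    (\sum_(k < N0) level_indic delta k.+1 p + small_count delta p)
      + (N0%:R^-1)%:E * num_parts p))%E.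
  rewrite -durationE; apply: (le_occupation chainX) => //.
    by apply: emeasurable_funD => //; exact: emeasurable_funD.
  move=> p [k pk]; have k0 := finite_partition_gt0 pk.
  have [kN|kN] := leqP k N0; last first.
    apply: (@le_trans _ _ ((N0%:R^-1)%:E * num_parts p)%E);
      last by rewrite leeDr// adde_ge0.
    rewrite [num_parts p](finite_part_count pk) -EFinM lee_fin mulrC ler_pdivlMr// mul1r.
    by rewrite ler_nat ltnW.
  apply: (@le_trans _ _ (\sum_(k < N0) level_indic delta k.+1 p + small_count delta
    p)%E); last first.
    by rewrite leeDl// mule_ge0.
  have sc : small_count delta p = (\sum_(i < k) small_part delta (p i))%:E.
    by apply: (finite_part_sum pk _ (small_part0 _)).
  have [all_large|] := pselect (forall i : 'I_k, delta <= p i).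
    have pl : level delta k p.
      split=> //; rewrite sc big1// => i _.
      by rewrite /small_part ltNge andbC ltNge all_large.
    apply: (@le_trans _ _ (level_indic delta k p)).
      by rewrite /level_indic indicE mem_set.
    have kk : (k.-1 < N0)%N by rewrite prednK.
    apply: le_trans (leeDl _ _); last exact: s0.
    rewrite (bigD1 (Ordinal kk))//= prednK// leeDl//.
    by apply: sume_ge0 => i _; exact: lev0.
  move=> /existsNP[i /negP]; rewrite -ltNge => pid.
  apply: le_trans (leeDr _ _); last exact: S0.
  rewrite sc lee_fin (bigD1 i)//= [X in X + _]/small_part pid andbT pk.1 ltn_ord lerDl.
  by apply: sumr_ge0.
rewrite (occupationD chainX)// in cover; last 3 first.
- by move=> p; rewrite adde_ge0.
- by move=> p; rewrite mule_ge0.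
- exact: emeasurable_funD.
rewrite (occupationD chainX)// (occupationZ chainX)// (occupation_sum chainX)// in cover.
have hl : (\sum_(k < N0) occupation P X n (level_indic delta k.+1) <= M%:E)%E.
  rewrite /M -sumEFin; apply: lee_sum => k _.
  exact: (level_occupation bm01 bs01 chainX d1).
have hc : ((N0%:R^-1)%:E * occupation P X n (@num_parts R) <= (4^-1 * duration n)%:E)%E.
  apply: (@le_trans _ _ ((N0%:R^-1)%:E * (C2 * duration n)%:E)%E).
    by apply: lee_wpmul2l; [rewrite lee_fin|exact: num_parts_occupation].
  by rewrite -EFinM lee_fin mulrA ler_wpM2r// mulrC.
have := le_trans cover (leeD (leeD hl hs) hc).
by rewrite -!EFinD lee_fin; lra.
Qed.

Lemma integral_positive_recurrent : positive_recurrent P X.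
Proof.
have [M hM] := duration_bound.
rewrite /positive_recurrent (integral_return_time bm01 bs01 sigma1 chainX).
apply: (@le_lt_trans _ _ M%:E); last exact: ltry.
apply: lime_le; first by apply: is_cvg_nneseries.
by apply: nearW => n; rewrite big_mkord -(occupation1 chainX) durationE lee_fin.
Qed.

End sufficiency.

Unset Implicit Arguments.

Theorem theorem2 (R : realType) (sigma : probability R R) (bm bs : R)
    (d : measure_display) (T : measurableType d) (P : probability T R)
    (X : nat -> T -> mass_partition R) :
  sigma `]0, 2^-1]%classic = 1%E ->
  0 < bm <= 1 -> 0 < bs <= 1 ->
  markov_chain (split_merge_kernel sigma bm bs) unit_partition P X ->
  (positive_recurrent P X <->
     (\int[sigma]_(x in `]0%R, 2^-1%R]) (x^-1)%:E < +oo)%E) /\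
  ((\int[lebesgue_measure]_(x in `]0%R, 2^-1%R]) (sigma `]0%R, x]%classic)^-1 < +oo)%E ->
     transient P X).
Proof.
move=> sigma1 bm01 bs01 chainX; split; last first.
  move=> sigma_inv; exact: (split_scale_transient bm01 bs01 sigma1 sigma_inv chainX).
split; first exact: (positive_recurrent_integral bm01 bs01 sigma1 chainX).
by move=> sigma_inv; exact: (integral_positive_recurrent bm01 bs01 sigma1 sigma_inv
  chainX).
Qed.
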